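(* Any planar graph $G=(V,E,\ell)$ with a set $T\subset V$ of $k$ terminals admits a $(3,\ \widetilde{\mathcal{O}}(k^2))$-DAM, where $\widetilde{\mathcal{O}}$ hides an absolute constant and factors polylogarithmic in $k$.
   Context: Graphs $G=(V,E,\ell)$ are finite and undirected, with an edge length function $\ell:E\to\mathbb{R}^+$ and a designated set $T\subset V$ of $k$ vertices called terminals; the other vertices are non-terminals. $d_G$ is the shortest-path distance. A minor of $G$ is a graph obtained by a sequence of vertex deletions, edge deletions and edge contractions, where no terminal may be deleted and no two terminals may be contracted together (so every terminal survives; a super-node containing terminal $t$ is identified with $t$); a minor carries its own edge length function $\ell'$. A minor $H=(V',E',\ell')$ of $G$ is an $\alpha$-distance approximating minor ($\alpha$-DAM) of $G$ if $d_G(t,t')\le d_H(t,t')\le\alpha\cdot d_G(t,t')$ for all $t,t'\in T$. It is an $(\alpha,y)$-DAM if in addition it has at most $y$ non-terminals. *)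

(* Defs.v *)
From HB Require Import structures.
From mathcomp Require Import all_boot all_order all_algebra.
From mathcomp Require Import all_classical all_reals all_analysis.

Set Implicit Arguments.
Unset Strict Implicit.
Unset Printing Implicit Defensive.

Import Order.TTheory GRing.Theory Num.Theory.
Import numFieldNormedType.Exports.

Local Open Scope ring_scope.

(** Finite simple undirected graphs.  The vertex set is a subset of an ambient
    finite type, so that all minors of a graph live over the same type; an edge
    is the (unordered) set of its two endpoints. *)
Record graph (V : finType) := Graph {
  verts : {set V};
  edges : {set {set V}};
  edges_wf : forall e, e \in edges -> (#|e| = 2)%N /\ e \subset verts }.

(** Only the values of a length function on the edges of [G] are relevant. *)
Definition positive_lengths (R : realType) (V : finType) (G : graph V)
    (l : {set V} -> R) : Prop :=
  forall e, e \in edges G -> 0 < l e.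

Definition adj (V : finType) (G : graph V) : rel V :=
  fun x y => [set x; y]%SET \in edges G.

(** Total length of the walk [x :: p]. *)
Definition walk_length (R : realType) (V : finType) (l : {set V} -> R)
    (x : V) (p : seq V) : R :=
  \sum_(a <- pairmap (fun u v => l [set u; v]%SET) x p) a.

(** Shortest-path distance; it is [+oo] between different components. *)
Definition dist (R : realType) (V : finType) (G : graph V) (l : {set V} -> R)
    (x y : V) : \bar R :=
  ereal_inf [set d | exists p : seq V,
    [/\ path (adj G) x p, last x p = y & d = (walk_length l x p)%:E]]%classic.

(** One minor operation on [G] with terminal set [T].  The super-node created
    by contracting the edge [u v] keeps the name [u].  As the two endpoints may
    not both be terminals, the endpoint [v] whose name disappears can always be
    taken to be a non-terminal; a super-node containing a terminal is thus
    named by that terminal.  Contraction discards the loop it creates and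
    merges parallel edges. *)
Inductive minor_op (V : finType) (T : {set V}) (G H : graph V) : Prop :=
| DeleteVertex v of v \in verts G & v \notin T
    & verts H = verts G :\ v
    & edges H = [set e in edges G | v \notin e]%SET
| DeleteEdge e of e \in edges G
    & verts H = verts G
    & edges H = edges G :\ e
| ContractEdge u v of [set u; v]%SET \in edges G & v \notin T
    & verts H = verts G :\ v
    & edges H = [set [set (if x == v then u else x) | x : V in e]%SET
                   | e : {set V} in edges G :\ [set u; v]%SET]%SET.

Inductive minor (V : finType) (T : {set V}) (G : graph V) : graph V -> Prop :=
| MinorRefl : minor T G G
| MinorStep H K of minor T G H & minor_op T H K : minor T G K.

(** [H] with lengths [l'] is an [alpha]-DAM of [G] with lengths [l]. *)
Definition DAM (R : realType) (V : finType) (T : {set V}) (alpha : R)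
    (G : graph V) (l : {set V} -> R) (H : graph V) (l' : {set V} -> R) : Prop :=
  [/\ minor T G H, positive_lengths H l' &
      forall t t', t \in T -> t' \in T ->
        (dist G l t t' <= dist H l' t t')%E /\
        (dist H l' t t' <= alpha%:E * dist G l t t')%E].

(** The existence of an [(alpha, y)]-DAM. *)
Definition admits_DAM (R : realType) (V : finType) (T : {set V}) (alpha : R)
    (y : nat) (G : graph V) (l : {set V} -> R) : Prop :=
  exists (H : graph V) (l' : {set V} -> R),
    DAM T alpha G l H l' /\ (#|verts H :\: T| <= y)%N.

(** Planarity: the graph can be drawn in the plane, with distinct points for
    vertices and simple continuous arcs, parametrised by [0, 1], for edges,
    which meet neither each other nor any vertex except at their endpoints. *)
Definition planar (R : realType) (V : finType) (G : graph V) : Prop :=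
  exists (pos : V -> R * R) (arc : {set V} -> R -> R * R),
  [/\ {in verts G &, injective pos},
      forall e, e \in edges G ->
        [/\ {within `[0, 1], continuous (arc e)}%classic,
            {in `[0, 1] &, injective (arc e)} &
            exists u v, [/\ e = [set u; v]%SET, arc e 0 = pos u
                          & arc e 1 = pos v]],
      forall e v (s : R), e \in edges G -> v \in verts G -> s \in `]0, 1[ ->
        arc e s <> pos v &
      forall e e' (s s' : R), e \in edges G -> e' \in edges G -> e <> e' ->
        s \in `]0, 1[ -> s' \in `]0, 1[ -> arc e s <> arc e' s'].

(** [g k] is in Õ([f k]): a constant and a factor polylogarithmic in [k] are
    hidden; [1 + trunc_log 2 k] stands for the logarithm so that the factor
    does not vanish at [k = 1]. *)
Definition softO (g f : nat -> nat) : Prop :=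
  exists C c : nat, forall k, (g k <= C * f k * (1 + trunc_log 2 k) ^ c)%N.

(* Main.v *)
(** Let [t] and [t'] be terminals, and let a shortest path between them meet a
    shortest path [P].  Going from [t] to the nearest vertex of [P], then along
    [P], then from [P] to [t'] by its nearest vertex costs at most three times
    the distance.  Hence it suffices to keep few shortest paths [P], and for each
    of them the shortest paths to it from some of the terminals, such that every
    path between two terminals meets some [P] to which both are attached.

    In a planar graph, for any choice of paths [P a] joining every vertex [a] to
    a root, four of them leave components with at most half of the terminals
    each.  To see this, draw the graph in a fine grid, every cell being labelled
    by a vertex.  If a heavy component always remained, the parity with which the
    loop through a step between two adjacent cells and the two corresponding
    paths winds around the heavy component would be a cocycle on the grid, but
    its sum along the boundary of the grid is odd.  Recursion on the components
    then yields O(k log k) paths.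

    After a perturbation of the lengths shortest paths are unique, so that two
    of them meet along a common segment.  Thus m of them have at most 2 m^2
    vertices where they end or part, and all other non-terminals of their union
    can be contracted. *)

From mathcomp Require Import all_boot zify.

Set Implicit Arguments.
Unset Strict Implicit.
Unset Printing Implicit Defensive.

(** * Winding parity on a grid *)

(** Planarity enters only through a labelling of grid cells by vertices in which every label class
    is connected and every edge is seen between two adjacent cells. Paths of the graph lift to walks
    of cells, and the parity of crossings with a ray takes the place of the Jordan curve theorem.

    Four paths are needed because a unit square has four corners. The cocycle on a step depends on
    the paths at its two ends, and its four values on a square can be compared only at a common
    centre. The heavy component left by all four paths supplies it: it lies in the heavy component
    left by any two of them, since two sets that each hold more than half of the terminals
    intersect.

    The boundary sum is odd because all boundary cells carry one label. A single centre then serves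
    the whole boundary, the contributions of the paths telescope to zero, and the ray from an inner
    cell leaves the grid exactly once.

    The perturbed lengths only select the paths; every distance is measured in the given lengths. *)

Definition restr (T : finType) (g : rel T) (X : pred T) : rel T :=
  [rel x y | [&& g x y, X x & X y]].

Lemma restr_sym (T : finType) (g : rel T) (X : pred T) :
  symmetric g -> symmetric (restr g X).
Proof. by move=> gS x y; rewrite /restr /= gS [X x && _]andbC. Qed.

Lemma connect_restr_sym (T : finType) (g : rel T) (X : pred T) :
  symmetric g -> connect_sym (restr g X).
Proof. by move=> gS; apply/sym_connect_sym/restr_sym. Qed.

Lemma connect_restr_mem (T : finType) (g : rel T) (X : pred T) x y :
  connect (restr g X) x y -> X x -> X y.
Proof.
case/connectP=> p + ->; elim: p x => //= z p IH x /andP[/and3P[_ _ Xz] gp] _.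
exact: IH.
Qed.

Lemma connect_restrW (T : finType) (g : rel T) (X Y : pred T) x y :
  subpred X Y -> connect (restr g X) x y -> connect (restr g Y) x y.
Proof.
move=> sXY; apply: connect_sub => u v /and3P[guv Xu Xv].
by apply: connect1; rewrite /restr /= guv !sXY.
Qed.

Lemma connect_lift (C V : finType) (h : rel C) (g : rel V) (lab : C -> V)
    (X : pred V) :
  (forall c c', lab c = lab c' ->
     connect (restr h (fun d => lab d == lab c)) c c') ->
  (forall c y, g (lab c) y ->
     exists d d', [/\ h d d', lab d = lab c & lab d' = y]) ->
  forall c c', X (lab c) -> connect (restr g X) (lab c) (lab c') ->
  connect (restr h (fun d => X (lab d))) c c'.
Proof.
move=> H1 H2 c c' Xc /connectP[p]; elim: p c Xc => [|y p IH] c Xc /=.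
  move=> _ /esym /H1; apply: connect_restrW => d /eqP->; exact: Xc.
case/andP=> /and3P[gcy _ Xy] gp lp.
have [d [d' [hd ld ld']]] := H2 _ _ gcy.
have cd : connect (restr h (fun d => X (lab d))) c d.
  by apply: connect_restrW (H1 _ _ (esym ld)) => e /eqP->.
apply: connect_trans cd _; apply: connect_trans (connect1 _) _; last first.
- by apply: (IH d'); rewrite ?ld'.
- by rewrite /restr /= hd ld ld' Xc Xy.
Qed.

Definition cell (N : nat) : finType := ('I_N.+1 * 'I_N.+1)%type.

Definition gadj (N : nat) : rel (cell N) := fun p q =>
  ((p.1 == q.1 :> nat) && ((p.2.+1 == q.2) || (q.2.+1 == p.2))) ||
  ((p.2 == q.2 :> nat) && ((p.1.+1 == q.1) || (q.1.+1 == p.1))).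

(* The step [p q] crosses the horizontal ray going right from [z], pushed
   slightly upwards. *)
Definition cross (N : nat) (z p q : cell N) : bool :=
  [&& z.1 < p.1, p.1 == q.1 :> nat &
    ((p.2 == z.2 :> nat) && (q.2 == z.2.+1 :> nat)) ||
    ((q.2 == z.2 :> nat) && (p.2 == z.2.+1 :> nat))].

Fixpoint wind (N : nat) (z p : cell N) (s : seq (cell N)) : bool :=
  if s is q :: s' then cross z p q (+) wind z q s' else false.

Lemma gadj_sym N : symmetric (@gadj N).
Proof. by move=> p q; rewrite /gadj; lia. Qed.

Lemma cell_neq N (p q : cell N) : p != q -> (p.1 != q.1 :> nat) || (p.2 != q.2 :> nat).
Proof. by case: p q => [a b] [c d]; rewrite xpair_eqE negb_and. Qed.

Lemma cross_move N (z z' : cell N) : gadj z z' ->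
  exists H : pred (cell N), forall p q, gadj p q ->
    z != p -> z != q -> z' != p -> z' != q ->
    cross z p q (+) cross z' p q = H p (+) H q.
Proof.
move=> zz'.
(* If [z'] is next to [z] in the same row, the two rays are crossed by the same
   steps; otherwise [H] is the part of the upper of the two rows lying to the
   right of [z]. *)
exists (fun p : cell N => [|| [&& z.1 == z'.1 :> nat, z.2.+1 == z'.2, p.2 == z'.2 :> nat & z.1 < p.1]
  | [&& z.1 == z'.1 :> nat, z'.2.+1 == z.2, p.2 == z.2 :> nat & z.1 < p.1]]).
move=> p q pq /cell_neq zp /cell_neq zq /cell_neq z'p /cell_neq z'q.
move: zz' pq zp zq z'p z'q; rewrite /gadj /cross.
move: z z' p q => [[a ia] [b ib]] [[a' ia'] [b' ib']] [[c ic] [d id]] [[c' ic'] [d' id']] /=.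
clear ia ib ia' ib' ic id ic' id'.
case/orP=> /andP[/eqP e1 /orP[]/eqP e2]; case/orP=> /andP[/eqP e3 /orP[]/eqP e4];
 subst; rewrite ?eqxx ?ltnn ?eqSS /=; lia.
Qed.

(** The two crossing parities differ by a coboundary, which telescopes along the walk. So a closed
    walk avoiding both cells winds around them with the same parity. *)
Lemma wind_move N (z z' : cell N) : gadj z z' ->
  exists H : pred (cell N), forall p s, path (@gadj N) p s ->
    z \notin p :: s -> z' \notin p :: s ->
    wind z p s (+) wind z' p s = H p (+) H (last p s).
Proof.
move=> zz'; have [H crH] := cross_move zz'; exists H => p s.
elim: s p => [|q s IH] p /=; first by rewrite addbb.
case/andP=> pq qs; rewrite !in_cons !negb_or.
case/and3P=> zp zq zs /and3P[z'p z'q z's].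
rewrite addbACA crH // IH ?in_cons ?negb_or ?zq ?z'q //.
by rewrite addbA addbK.
Qed.

(** Only the two vertical sides can meet the ray, and it meets both or neither unless it starts at
    the corner [c i j]. *)
Lemma cross_square N (z : cell N) (i j : nat) : i < N -> j < N ->
  let c i j : cell N := (inord i, inord j) in
  z \notin [:: c i j; c i.+1 j; c i j.+1; c i.+1 j.+1] ->
  cross z (c i j) (c i.+1 j) (+) cross z (c i.+1 j) (c i.+1 j.+1) (+)
  (cross z (c i j.+1) (c i.+1 j.+1) (+) cross z (c i j) (c i j.+1)) = false.
Proof.
move=> iN jN c; rewrite !inE !negb_or => /and4P[/cell_neq + _ _ _].
rewrite /c /cross /= !inordK; try lia.
Qed.

Lemma big_addb_telescope (f : nat -> bool) n :
  \big[addb/false]_(i < n) (f i (+) f i.+1) = f 0 (+) f n.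
Proof.
elim: n => [|n IH]; first by rewrite big_ord0 addbb.
by rewrite big_ord_recr /= IH addbA addbK.
Qed.

(** Green's formula modulo 2: a step inside the grid belongs to two unit squares and cancels. *)
Lemma addb_green (hH hV : nat -> nat -> bool) n :
  \big[addb/false]_(i < n) \big[addb/false]_(j < n)
     ((hH i j (+) hV i.+1 j) (+) (hH i j.+1 (+) hV i j)) =
  \big[addb/false]_(i < n) (hH i 0 (+) hH i n) (+)
  \big[addb/false]_(j < n) (hV 0 j (+) hV n j).
Proof.
under eq_bigr => i _.
  under eq_bigr => j _ do rewrite addbACA [hV _ _ (+) hV _ _]addbC.
  rewrite big_split /= (big_addb_telescope (hH i)); over.
rewrite big_split /=; congr (_ (+) _).
by rewrite exchange_big /=; apply: eq_bigr => j _; rewrite (big_addb_telescope (hV^~ j)).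
Qed.

(** As [connect] is reflexive, this is the singleton of [x] when [x] lies in [S]. *)
Definition component (V : finType) (g : rel V) (S : {set V}) (x : V) : {set V} :=
  [set y | connect (restr g (fun v => v \notin S)) x y].

Definition boundary N (c : cell N) : bool :=
  [|| c.1 == 0 :> nat, c.1 == N :> nat, c.2 == 0 :> nat | c.2 == N :> nat].

Lemma grid_row_connect N (X : pred (cell N)) j : (forall i, X (i, j)) ->
  forall i i', connect (restr (@gadj N) X) (i, j) (i', j).
Proof.
move=> Xj; suff H i : connect (restr (@gadj N) X) (i, j) (ord0, j).
  by move=> i i'; apply: connect_trans (H i) _; rewrite connect_restr_sym //; exact: gadj_sym.
case: i => n; elim: n => [|n IH] n1.
  by rewrite (_ : Ordinal n1 = ord0) //; apply: val_inj.
apply: connect_trans (IH (ltnW n1)); apply: connect1.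
by rewrite /restr /= !Xj /gadj /= !eqxx !orbT.
Qed.

Lemma grid_col_connect N (X : pred (cell N)) i : (forall j, X (i, j)) ->
  forall j j', connect (restr (@gadj N) X) (i, j) (i, j').
Proof.
move=> Xi; suff H j : connect (restr (@gadj N) X) (i, j) (i, ord0).
  by move=> j j'; apply: connect_trans (H j) _; rewrite connect_restr_sym //; exact: gadj_sym.
case: j => n; elim: n => [|n IH] n1.
  by rewrite (_ : Ordinal n1 = ord0) //; apply: val_inj.
apply: connect_trans (IH (ltnW n1)); apply: connect1.
by rewrite /restr /= !Xi /gadj /= !eqxx !orbT.
Qed.

Lemma grid_connected N (c c' : cell N) : connect (@gadj N) c c'.
Proof.
have sub : subrel (restr (@gadj N) predT) (connect (@gadj N)).
  by move=> x y /and3P[xy _ _]; apply: connect1.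
apply: connect_sub sub _ _ _; case: c c' => [i j] [i' j'].
exact: connect_trans (grid_row_connect _ _ i') (grid_col_connect _ _ _).
Qed.

Lemma boundary_connected N (c c' : cell N) : boundary c -> boundary c' ->
  connect (restr (@gadj N) (@boundary N)) c c'.
Proof.
suff H d : boundary d -> connect (restr (@gadj N) (@boundary N)) d (ord0, ord0).
  move=> /H bc /H bc'; apply: connect_trans bc _.
  by rewrite connect_restr_sym //; exact: gadj_sym.
have r0 i i' : connect (restr (@gadj N) (@boundary N)) (i, ord0) (i', ord0).
  by apply: grid_row_connect => k; rewrite /boundary /= ?eqxx ?orbT.
have c0 j j' : connect (restr (@gadj N) (@boundary N)) (ord0, j) (ord0, j').
  by apply: grid_col_connect => k; rewrite /boundary /= ?eqxx.
case: d => i j; rewrite /boundary /= => /or4P[]/eqP e.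
- by rewrite (_ : i = ord0) //; apply: val_inj.
- apply: connect_trans (r0 i _); apply: grid_col_connect => k.
  by rewrite /boundary /= e eqxx orbT.
- by rewrite (_ : j = ord0) //; apply: val_inj.
- apply: connect_trans (c0 j _); apply: grid_row_connect => k.
  by rewrite /boundary /= e eqxx !orbT.
Qed.

(** Enlarging [S] shrinks components, so the components of [x] and [y] off [S] both hold more than
    half of [A], and therefore meet. *)
Lemma heavy_comp_connect (V : finType) (g : rel V) (A S S' : {set V}) x y :
  symmetric g -> S \subset S' ->
  #|A| < 2 * #|A :&: component g S x| -> #|A| < 2 * #|A :&: component g S' y| ->
  connect (restr g (fun v => v \notin S)) x y.
Proof.
move=> gS sSS' hx hy'.
have sub : component g S' y \subset component g S y.
  apply/subsetP => w; rewrite !inE; apply: connect_restrW => v.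
  by apply: contra; apply: (subsetP sSS').
have hy : #|A| < 2 * #|A :&: component g S y|.
  by apply: leq_trans hy' _; rewrite leq_mul2l subset_leq_card ?orbT ?setIS.
have : #|(A :&: component g S x) :|: (A :&: component g S y)| <= #|A|.
  by rewrite subset_leq_card // -setIUr subsetIl.
have := cardsUI (A :&: component g S x) (A :&: component g S y).
case: (set_0Vmem ((A :&: component g S x) :&: (A :&: component g S y))) => [->|[w]]; last first.
  rewrite !inE => /andP[/andP[_ xw] /andP[_ yw]] _ _.
  by apply: connect_trans xw _; rewrite connect_restr_sym.
rewrite cards0; lia.
Qed.

Lemma grid_separator (V : finType) (g : rel V) (N : nat) (lab : cell N -> V)
    (P : V -> {set V}) (r0 : cell N) (A : {set V}) :
  symmetric g ->
  (forall c c', lab c = lab c' ->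
     connect (restr (@gadj N) (fun d => lab d == lab c)) c c') ->
  (forall c y, g (lab c) y ->
     exists d d', [/\ gadj d d', lab d = lab c & lab d' = y]) ->
  (forall c c', boundary c -> boundary c' -> lab c = lab c') ->
  (forall c, lab c \in P (lab c)) ->
  (forall c, connect (restr g (mem (P (lab c)))) (lab c) (lab r0)) ->
  A \subset codom lab ->
  exists a b c d, let S := P (lab a) :|: P (lab b) :|: (P (lab c) :|: P (lab d)) in
    forall x, x \notin S -> 2 * #|A :&: component g S x| <= #|A|.
Proof.
move=> gS H1 H2 Hb Pin Pc Acod; pose Q c := P (lab c).
change (exists a b c d, let S := Q a :|: Q b :|: (Q c :|: Q d) in
  forall x, x \notin S -> 2 * #|A :&: component g S x| <= #|A|).
pose hv (S : {set V}) c := (lab c \notin S) && (#|A| < 2 * #|A :&: component g S (lab c)|).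
have [bal|nbal] := boolP [exists a, exists b, exists c, exists d,
  [forall x, (x \notin Q a :|: Q b :|: (Q c :|: Q d)) ==>
    (2 * #|A :&: component g (Q a :|: Q b :|: (Q c :|: Q d)) x| <= #|A|)]].
  case/existsP: bal => a /existsP[b /existsP[c /existsP[d /forallP Hx]]].
  by exists a, b, c, d => S x xS; have := Hx x; rewrite xS.
exfalso.
have {nbal} ex_hv a b c d : exists z, hv (Q a :|: Q b :|: (Q c :|: Q d)) z.
  move: nbal; rewrite negb_exists => /forallP/(_ a).
  rewrite negb_exists => /forallP/(_ b); rewrite negb_exists => /forallP/(_ c).
  rewrite negb_exists => /forallP/(_ d); rewrite negb_forall => /existsP[x].
  set S := _ :|: (_ :|: _); rewrite negb_imply -ltnNge => /andP[xS hx].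
  (* The vertex [x] need not be a label, but its component meets [A], whose elements are labels. *)
  have /set0Pn[w] : A :&: component g S x != set0.
    by apply: contraL hx => /eqP->; rewrite cards0.
  rewrite !inE => /andP[wA xw].
  have /codomP[z wz] := subsetP Acod _ wA.
  exists z; rewrite /hv -wz (connect_restr_mem xw xS).
  suff -> : component g S w = component g S x by [].
  apply/setP => v; rewrite !inE; apply/esym/same_connect => //.
  exact: connect_restr_sym.
pose beta S := odflt r0 [pick z | hv S z].
have hbeta a b c d : hv (Q a :|: Q b :|: (Q c :|: Q d)) (beta (Q a :|: Q b :|: (Q c :|: Q d))).
  rewrite /beta; case: pickP => [z //|no]; have [z hz] := ex_hv a b c d.
  by rewrite no in hz.
have hbeta2 a b : hv (Q a :|: Q b) (beta (Q a :|: Q b)).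
  by have := hbeta a b a b; rewrite setUid.
have ex_g p : exists s, [&& path (@gadj N) p s, last p s == r0 &
    all (fun c => lab c \in P (lab p)) (p :: s)].
  have /connectP[s ps ls] := connect_lift H1 H2 (Pin p) (Pc p).
  exists s; rewrite -ls eqxx; move: (P (lab p)) (Pin p) ps => X.
  elim: s p {ls} => [|q s IH] p Xp /=; first by rewrite Xp.
  case/andP=> /and3P[pq _ Xq] /(IH _ Xq)/and3P[-> _ /= ->].
  by rewrite pq Xp.
(* [W z p q] is the winding parity around [z] of the closed walk made of the
   step [p q] and of walks from its ends to [r0]. For [z] a cell of the heavy
   component left by [Q p] and [Q q] it defines a cocycle [h]: on a unit square
   the four values can be computed at the same [z], outside the square. But [h]
   sums to 1 along the boundary of the grid. *)
pose gam p := xchoose (ex_g p).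
pose F z p := wind z p (gam p).
pose W z p q := F z p (+) F z q (+) cross z p q.
(* The centre moves along a lifted walk avoiding [S]. Each move changes the three terms of [W] by
   values of one function [H] at [p], [q] and [r0], and each value occurs twice. *)
have W_conn (S : {set V}) p q z z' : gadj p q -> Q p :|: Q q \subset S ->
    lab z \notin S -> connect (restr g (fun v => v \notin S)) (lab z) (lab z') -> W z p q = W z' p q.
  move=> pq sS zS zz'; have /connectP[s] := connect_lift H1 H2 (X := fun v => v \notin S) zS zz'.
  elim: s z zS {zz'} => [|y s IH] z zS /=; first by move=> _ ->.
  case/andP=> /and3P[zy _ yS] ps ls; rewrite -(IH y) //.
  have [H HH] := wind_move zy.
  have av x t : x \in p |: [set q] -> lab t \notin S -> t \notin x :: gam x.
    rewrite !inE => xpq tS; have := xchooseP (ex_g x); rewrite -/(gam x) => /and3P[_ _ /allP al].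
    apply: contra tS => /al; apply: (subsetP (subset_trans _ sS)).
    by case/orP: xpq => /eqP->; rewrite ?subsetUl ?subsetUr.
  have FH x : x \in p |: [set q] -> F z x = F y x (+) H x (+) H r0.
    move=> xpq; have /and3P[px /eqP lx _] := xchooseP (ex_g x).
    have := HH x (gam x) px (av _ _ xpq zS) (av _ _ xpq yS); rewrite lx.
    by rewrite -/(F z x) -/(F y x) => e; rewrite -addbA -e addbCA addbb addbF.
  have := HH p [:: q]; rewrite /= pq !addbF => /(_ isT).
  have mem2 t : lab t \notin S -> t \notin [:: p; q].
    move=> tS; rewrite !inE negb_or; apply/andP; split.
      by have := av p t; rewrite !inE eqxx => /(_ isT tS); rewrite negb_or => /andP[].
    by have := av q t; rewrite !inE eqxx orbT => /(_ isT tS); rewrite negb_or => /andP[].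
  rewrite !mem2 // => /(_ isT isT) eH.
  rewrite /W !FH ?inE ?eqxx ?orbT //.
  by move: eH; case: (F y p); case: (F y q); case: (H p); case: (H q); case: (H r0);
    case: (cross z p q); case: (cross y p q).
pose h p q := W (beta (Q p :|: Q q)) p q.
(* This moves the centre from the heavy component of two paths into that of four. *)
have h_eq a b c d p q : gadj p q ->
    Q p :|: Q q \subset Q a :|: Q b :|: (Q c :|: Q d) ->
    h p q = W (beta (Q a :|: Q b :|: (Q c :|: Q d))) p q.
  move=> pq sS; have /andP[n1 b1] := hbeta2 p q.
  have /andP[_ b2] := hbeta a b c d.
  apply: W_conn (subxx _) n1 _ => //.
  exact: heavy_comp_connect sS b1 b2.
pose c i j : cell N := (inord i, inord j).
have adjH i j : i < N -> j <= N -> gadj (c i j) (c i.+1 j).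
  by move=> ??; rewrite /gadj /= !inordK; lia.
have adjV i j : i <= N -> j < N -> gadj (c i j) (c i j.+1).
  by move=> ??; rewrite /gadj /= !inordK; lia.
have := addb_green (fun i j => h (c i j) (c i.+1 j)) (fun i j => h (c i j) (c i j.+1)) N.
rewrite big1 => [|i _]; last first.
  rewrite big1 // => j _.
  have [iN jN] := (ltn_ord i, ltn_ord j); have [iN' jN'] := (ltnW iN, ltnW jN).
  set a := c i j; set b := c i.+1 j; set d := c i j.+1; set e := c i.+1 j.+1.
  have eqh := h_eq a b d e.
  have /andP[n1 _] := hbeta a b d e.
  have znot t : t \in [:: a; b; d; e] -> beta (Q a :|: Q b :|: (Q d :|: Q e)) != t.
    move=> tin; apply: contra n1 => /eqP->; move: tin.
    by rewrite !inE /Q => /or4P[]/eqP<-; rewrite Pin ?orbT.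
  have sq := @cross_square N (beta (Q a :|: Q b :|: (Q d :|: Q e))) i j iN jN.
  have {}sq := sq _.
  rewrite !eqh ?adjH ?adjV // /W -/(c _ _).
  - have {}sq : _ = false := sq _; move: sq; rewrite /= -!/(c _ _) !inE !negb_or.
    rewrite !znot ?inE ?eqxx ?orbT // => /(_ isT).
    set z' := beta _; case: (F z' (c i j)); case: (F z' (c i.+1 j));
      case: (F z' (c i j.+1)); case: (F z' (c i.+1 j.+1)); case: (cross z' _ _);
      case: (cross z' _ _); case: (cross z' _ _); by case: (cross z' _ _).
  - by rewrite subUset; apply/andP; split; apply/subsetP => v; rewrite !inE => ->; rewrite ?orbT.
  - by rewrite subUset; apply/andP; split; apply/subsetP => v; rewrite !inE => ->; rewrite ?orbT.
  - by rewrite subUset; apply/andP; split; apply/subsetP => v; rewrite !inE => ->; rewrite ?orbT.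
  - by rewrite subUset; apply/andP; split; apply/subsetP => v; rewrite !inE => ->; rewrite ?orbT.
have c_bd i j : (i <= N) && (j <= N) && [|| i == 0, i == N, j == 0 | j == N] -> boundary (c i j).
  by rewrite /boundary /= => /andP[/andP[iN jN]]; rewrite !inordK.
pose v0 := lab (c 0 0).
have lab_bd i j : (i <= N) && (j <= N) && [|| i == 0, i == N, j == 0 | j == N] -> lab (c i j) = v0.
  by move=> /c_bd bij; apply: Hb bij (c_bd 0 0 _); rewrite !leq0n eqxx.
have /andP[n0 _] := hbeta2 (c 0 0) (c 0 0).
pose z0 := beta (Q (c 0 0) :|: Q (c 0 0)); rewrite -/z0 in n0.
have h_bd p q : lab p = v0 -> lab q = v0 -> h p q = F z0 p (+) F z0 q (+) cross z0 p q.
  by move=> ep eq; rewrite /h /W /Q ep eq -/v0 -/z0.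
(* The label [v0] of the boundary lies in its own path, which [z0] avoids, so [z0] is an inner
   cell. *)
have [x0 y0] : z0.1 < N /\ z0.2 < N.
  have nb : ~~ boundary z0.
    apply: contra n0 => bz; have bc := c_bd 0 0 isT.
    by rewrite (Hb _ _ bz bc) -/v0 inE orbb; apply: Pin.
  move: nb; rewrite /boundary; have := ltn_ord z0.1; have := ltn_ord z0.2; lia.
have sumH : \big[addb/false]_(i < N) (h (c i 0) (c i.+1 0) (+) h (c i N) (c i.+1 N)) =
    F z0 (c 0 0) (+) F z0 (c N 0) (+) (F z0 (c 0 N) (+) F z0 (c N N)).
  rewrite -(big_addb_telescope (fun i => F z0 (c i 0))).
  rewrite -(big_addb_telescope (fun i => F z0 (c i N))) -big_split /=.
  apply: eq_bigr => i _; have iN := ltn_ord i; have iN' := ltnW iN.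
  rewrite !h_bd ?lab_bd ?iN ?iN' ?leq0n ?leqnn ?eqxx ?orbT //.
  have cr j : cross z0 (c i j) (c i.+1 j) = false.
    by rewrite /cross /= (@inordK N i) ?(@inordK N i.+1) //; lia.
  by rewrite !cr !addbF.
(* The ray from [z0] crosses one boundary step, in the right column at the height of [z0]; this is
   the final [true]. *)
have sumV : \big[addb/false]_(j < N) (h (c 0 j) (c 0 j.+1) (+) h (c N j) (c N j.+1)) =
    F z0 (c 0 0) (+) F z0 (c 0 N) (+) (F z0 (c N 0) (+) F z0 (c N N)) (+) true.
  have sum1 : \big[addb/false]_(j < N) (j == z0.2 :> nat) = true.
    rewrite (bigD1 (Ordinal y0)) //= eqxx big1 ?addbF // => j.
    by rewrite -val_eqE /= => /negbTE.
  rewrite -[in RHS]sum1 -(big_addb_telescope (fun j => F z0 (c 0 j))).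
  rewrite -(big_addb_telescope (fun j => F z0 (c N j))) -!big_split /=.
  apply: eq_bigr => j _; have jN := ltn_ord j; have jN' := ltnW jN.
  rewrite !h_bd ?lab_bd ?jN ?jN' ?leq0n ?leqnn ?eqxx ?orbT //.
  have -> : cross z0 (c 0 j) (c 0 j.+1) = false.
    by rewrite /cross /= ?(@inordK N 0) ?(@inordK N N) ?(@inordK N j) ?(@inordK N j.+1) //; lia.
  have -> : cross z0 (c N j) (c N j.+1) = (j == z0.2 :> nat).
    rewrite /cross /= ?(@inordK N 0) ?(@inordK N N) ?(@inordK N j) ?(@inordK N j.+1) //.
    by rewrite x0 eqxx eqSS andTb; case: eqP; lia.
  by rewrite addbF addbA.
rewrite sumH sumV.
by case: (F z0 (c 0 0)); case: (F z0 (c 0 N)); case: (F z0 (c N 0)); case: (F z0 (c N N)).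
Qed.

(** * Labelling a grid by vertices *)

Definition connected_classes (C : finType) (W : eqType) (h : rel C) (lab : C -> W) (w : W) :=
  forall c c', lab c = w -> lab c' = w -> connect (restr h (fun d => lab d == w)) c c'.

Lemma connect_restr_add (C : finType) (h : rel C) (X Y : pred C) p q :
  symmetric h -> (forall c c', X c -> X c' -> connect (restr h X) c c') ->
  (forall c c', Y c -> Y c' -> connect (restr h Y) c c') ->
  h p q -> X p -> Y q ->
  forall c c', X c || Y c -> X c' || Y c' -> connect (restr h (predU X Y)) c c'.
Proof.
move=> hS cX cY hpq Xp Yq.
have cXp c : X c || Y c -> connect (restr h (predU X Y)) c p.
  case/orP=> [Xc|Yc].
    by apply: connect_restrW (cX _ _ Xc Xp) => d /= ->.
  apply: connect_trans (connect1 _).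
    by apply: connect_restrW (cY _ _ Yc Yq) => d /= ->; rewrite orbT.
  by rewrite /restr /= Xp Yq orbT hS hpq.
move=> c c' hc hc'; apply: connect_trans (cXp _ hc) _.
by rewrite connect_restr_sym //; apply: cXp.
Qed.

(** By connectedness of [h] some unlabelled cell is next to a labelled one and can join its class,
    which stays connected. Induction is on the number of unlabelled cells. *)
Lemma extend_labelling (C : finType) (V : eqType) (h : rel C) (lab0 : C -> option V)
    (B : pred C) (c0 : C) (v0 : V) :
  symmetric h -> (forall c c', connect h c c') ->
  lab0 c0 = Some v0 ->
  (forall v, connected_classes h lab0 (Some v)) ->
  (forall c, B c -> lab0 c = None) ->
  (forall c c', B c -> B c' -> connect (restr h B) c c') ->
  exists lab : C -> V,
    [/\ forall c v, lab0 c = Some v -> lab c = v,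
        forall c, exists c', lab0 c' = Some (lab c),
        forall v, connected_classes h lab v &
        forall c c', B c -> B c' -> lab c = lab c'].
Proof.
move=> hS hC l0 cc BN cB.
suff {BN l0} H n (lab1 : C -> option V) : #|[pred c | lab1 c == None]| <= n ->
    lab1 c0 = Some v0 ->
    (forall v, connected_classes h lab1 (Some v)) ->
    (forall c c', B c -> B c' -> lab1 c = lab1 c') ->
    (forall c v, lab1 c = Some v -> exists c', lab0 c' = Some v) ->
    (forall c v, lab0 c = Some v -> lab1 c = Some v) ->
    exists lab : C -> V,
    [/\ forall c v, lab0 c = Some v -> lab c = v,
        forall c, exists c', lab0 c' = Some (lab c),
        forall v, connected_classes h lab v &
        forall c c', B c -> B c' -> lab c = lab c'].
  apply: (H _ lab0 (leqnn _)) => // [c c' Bc Bc'|c v]; first by rewrite !BN.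
  by exists c.
elim: n lab1 => [|n IH] lab1 sz l1 cc1 B1 im1 ext1.
  have all1 c : lab1 c = Some (odflt v0 (lab1 c)).
    case E : (lab1 c) => [v //|].
    by move: sz; rewrite leqn0 => /eqP/card0_eq/(_ c); rewrite inE E.
  exists (fun c => odflt v0 (lab1 c)); split.
  - by move=> c v /ext1 ->.
  - by move=> c; apply: (im1 c).
  - move=> v c c' ec ec'.
    have := cc1 v c c'; rewrite (all1 c) (all1 c') ec ec' => /(_ erefl erefl).
    by apply: connect_restrW => d /eqP->.
  - by move=> c c' Bc Bc'; rewrite (B1 c c').
have [noN|[c1 N1]] : (forall c, lab1 c != None) \/ exists c, lab1 c = None.
  case: (boolP [forall c, lab1 c != None]) => [/forallP|]; first by left.
  by rewrite negb_forall => /existsP[c]; rewrite negbK => /eqP; right; exists c.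
  apply: (IH lab1) => //.
  by rewrite (@eq_card0 _ [pred c | lab1 c == None]) // => c; rewrite inE; apply/negbTE/noN.
have [p [q [v [hpq lp lq]]]] : exists p q v, [/\ h p q, lab1 p = Some v & lab1 q = None].
  case/connectP: (hC c0 c1) => s ps ls; rewrite {}ls in N1.
  elim: s (c0) (v0) l1 ps N1 => [|y s IHs] c v lc /=; first by rewrite lc.
  case/andP=> hcy hs N1; case E : (lab1 y) => [w|]; first exact: (IHs y w).
  by exists c, y, v.
(* Once [B] is reached, it is absorbed as one block, which gives it a single label. *)
pose Y := if B q then B else pred1 q.
have Yq : Y q by rewrite /Y; case: ifP => //= _; rewrite eqxx.
have YN c : Y c -> lab1 c = None.
  by rewrite /Y; case: ifP => [Bq Bc|_ /eqP-> //]; rewrite -lq; apply: B1.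
have cY c c' : Y c -> Y c' -> connect (restr h Y) c c'.
  by rewrite /Y; case: ifP => [_|_ /eqP-> /eqP->]; [apply: cB|rewrite connect0].
pose lab2 c := if Y c then Some v else lab1 c.
apply: (IH lab2).
- rewrite -ltnS; apply: leq_trans sz; apply: proper_card; apply/properP; split.
    by apply/subsetP => c; rewrite !inE /lab2; case: ifP.
  by exists q; rewrite !inE ?lq // /lab2 Yq.
- by rewrite /lab2; case: ifP => // /YN; rewrite l1.
- move=> w c c'; rewrite /lab2 => ec ec'.
  have [ewv|nvw] := eqVneq w v; first subst w; last first.
    move: ec ec'; case: ifP => [_ [e]|Yc ec]; first by rewrite e eqxx in nvw.
    case: ifP => [_ [e]|Yc' ec']; first by rewrite e eqxx in nvw.
    apply: connect_restrW (cc1 w c c' ec ec') => d /eqP ed.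
    by case: ifP => [/YN|]; rewrite ed.
  pose X c := lab1 c == Some v.
  have cX d d' : X d -> X d' -> connect (restr h X) d d' by move=> /eqP + /eqP; apply: cc1.
  have Xp : X p by rewrite /X lp.
  have mem2 d : lab2 d = Some v -> X d || Y d.
    by rewrite /lab2 /X; case: ifP => [_ _|_ ->]; rewrite ?eqxx ?orbT.
  apply: connect_restrW (connect_restr_add hS cX cY hpq Xp Yq (mem2 _ ec) (mem2 _ ec')) => d /=.
  by rewrite /X; case: ifP => // _; rewrite orbF.
- move=> c c' Bc Bc'; rewrite /lab2 (B1 c c') //; congr (if _ then _ else _).
  rewrite /Y; case: ifP => [_|Bq] /=; first by rewrite Bc Bc'.
  by case: eqP Bc => [->|_]; rewrite ?Bq //; case: eqP Bc' => [->|]; rewrite ?Bq.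
- move=> c w; rewrite /lab2; case: ifP => [_ [<-]|_]; [exact: (im1 p)|exact: im1].
- by move=> c w /[dup] /ext1 e e0; rewrite /lab2; case: ifP => // /YN; rewrite e.
Qed.

(* The class of [v] consists of the first quarters of the walks from [v] and,
   for one orientation of each edge, of the walk from [v] stopped before it
   meets the first quarters at the other end. *)
Lemma walks_labelling (C V : finType) (h : rel C) (e : rel V) (D : {set V})
    (w : V -> V -> nat -> C) (n : nat) :
  symmetric h -> symmetric e -> irreflexive e ->
  (forall v u k, v \in D -> k < 3 * n -> w v u k = w v u k.+1 \/ h (w v u k) (w v u k.+1)) ->
  (forall v u u', v \in D -> w v u 0 = w v u' 0) ->
  (forall x y, x \in D -> y \in D -> e x y -> w x y (3 * n) = w y x n) ->
  (forall v u v' u' k k', v \in D -> v' \in D -> v != v' ->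
     (k <= n /\ k' <= n) \/
     ([set v; u]%SET != [set v'; u']%SET /\ k <= 3 * n /\ k' <= 3 * n) ->
     w v u k <> w v' u' k') ->
  exists lab : C -> option V,
  [/\ forall c v, lab c = Some v -> v \in D /\ exists u k, k <= 3 * n /\ c = w v u k,
      forall v, connected_classes h lab (Some v),
      forall v, v \in D -> exists c, lab c = Some v &
      forall x y, x \in D -> y \in D -> e x y ->
        exists c c', [/\ h c c', lab c = Some x & lab c' = Some y]].
Proof.
move=> hS eS eI w1 w2 w3 w4.
pose small v c := [exists u, exists k : 'I_n.+1, c == w v u k].
pose stop v u k := [forall j : 'I_k.+1, ~~ small u (w v u j)].
pose long v c := [exists u, exists k : 'I_(3 * n),
  [&& u \in D, e v u, enum_rank v < enum_rank u, stop v u k & c == w v u k]].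
pose cls v c := small v c || long v c.
have smallP v c : reflect (exists u k, k <= n /\ c = w v u k) (small v c).
  apply: (iffP existsP) => [[u /existsP[k /eqP->]]|[u [k [kn ->]]]]; exists u.
    by exists k; rewrite -ltnS.
  by apply/existsP; exists (Ordinal (kn : k < n.+1)).
have longP v c : reflect (exists u k, [/\ u \in D, e v u, enum_rank v < enum_rank u,
    stop v u k & k < 3 * n /\ c = w v u k]) (long v c).
  apply: (iffP existsP) => [[u /existsP[k /and5P[??? s /eqP->]]]|[u [k [??? s [kn ->]]]]]; exists u.
    by exists k.
  by apply/existsP; exists (Ordinal kn); apply/and5P.
have stopP v u k j : stop v u k -> j <= k -> ~~ small u (w v u j).
  by move=> /forallP s jk; apply: (s (Ordinal (jk : j < k.+1))).
(* If the walk from [v'] leads to [v], it was stopped before the first quarters of [v]. Otherwise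
   [v] lies outside the pair of the long walk, so the pairs differ and the walks are disjoint. *)
have small_long v v' c : v \in D -> v' \in D -> v != v' -> small v c -> long v' c -> False.
  move=> vD v'D nv sm /longP[u' [k' [u'D ev' rk st [kn ec]]]].
  have [eu|nu] := eqVneq u' v.
    by have := stopP _ _ _ _ st (leqnn k'); rewrite -ec eu sm.
  case/smallP: sm => u [k [kn' ec']]; rewrite ec in ec'; apply: (w4 _ _ _ _ _ _ _ _ _ _ (esym ec')) => //.
  right; split; last by lia.
  by apply/eqP => /setP/(_ v); rewrite !inE eqxx (negbTE nv) [v == u']eq_sym (negbTE nu).
have cls_inj v v' c : v \in D -> v' \in D -> cls v c -> cls v' c -> v = v'.
  move=> vD v'D; case: (eqVneq v v') => // nv /orP[] h1 /orP[] h2.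
  - move: h2; case/smallP: h1 => u [k [kn ->]] h2; case/smallP: h2 => u' [k' [kn' ec]].
    by case: (w4 v u v' u' k k' vD v'D nv _ ec); left.
  - by case: (small_long v v' c).
  - by case: (small_long v' v c) => //; rewrite eq_sym.
  (* Two long walks on the same pair would run in opposite directions, and only the one from the
     smaller rank is kept. *)
  - move: h2; case/longP: h1 => u [k [uD ev rk _ [kn ->]]] h2; case/longP: h2 => u' [k' [u'D ev' rk' _ [kn' ec]]].
    case: (w4 v u v' u' k k' vD v'D nv _ ec); right; split; last by lia.
    apply/eqP => /setP E; have := E v; have := E v'; rewrite !inE !eqxx (negbTE nv) [v' == v]eq_sym (negbTE nv) /=.
    move=> /eqP e1 /esym/eqP e2; subst u u'; lia.
pose lab c := [pick v | (v \in D) && cls v c].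
have labP c v : v \in D -> cls v c -> lab c = Some v.
  move=> vD vc; rewrite /lab; case: pickP => [v' /andP[v'D v'c]|/(_ v)]; last by rewrite vD vc.
  by rewrite (cls_inj v v' c).
have labE c v : lab c = Some v -> v \in D /\ cls v c.
  by rewrite /lab; case: pickP => // v' /andP[v'D v'c] [<-].
have small0 v : v \in D -> small v (w v v 0).
  by move=> vD; apply/smallP; exists v, 0.
have toroot v c : v \in D -> cls v c -> connect (restr h (fun d => lab d == Some v)) c (w v v 0).
  move=> vD hc.
  have [u [k [ck ec kn]]] : exists u k, [/\ forall j, j <= k -> cls v (w v u j), c = w v u k & k <= 3 * n].
    case/orP: hc => [/smallP[u [k [kn ->]]]|/longP[u [k [uD ev rk st [kn ->]]]]]; exists u, k; split => //; try lia.
      by move=> j jk; apply/orP; left; apply/smallP; exists u, j; split => //; lia.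
    move=> j jk; apply/orP; right; apply/longP; exists u, j; split => //; last by split=> //; lia.
    by apply/forallP => i; apply: stopP st _; have := ltn_ord i; lia.
  rewrite {}ec {hc} (w2 _ _ u vD); elim: k ck kn => [|k IH] ck kn; first exact: connect0.
  have IH' : connect (restr h (fun d => lab d == Some v)) (w v u k) (w v u 0).
    by apply: IH; [move=> j jk; apply: ck|]; lia.
  case: (w1 v u k vD kn) => [<- //|hk]; apply: connect_trans IH'; apply: connect1.
  by rewrite /restr /= hS hk !(labP _ v) ?eqxx //; apply: ck; lia.
exists lab; split.
- move=> c v /labE[vD /orP[/smallP[u [k [kn ->]]]|/longP[u [k [_ _ _ _ [kn ->]]]]]];
    split=> //; exists u, k; split=> //; lia.
- move=> v c c' /labE[vD vc] /labE[_ vc']; apply: connect_trans (toroot _ _ vD vc) _.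
  by rewrite connect_restr_sym //; apply: toroot.
- by move=> v vD; exists (w v v 0); apply: labP => //; rewrite /cls small0.
suff H x y : x \in D -> y \in D -> e x y -> enum_rank x < enum_rank y ->
    exists c c', [/\ h c c', lab c = Some x & lab c' = Some y].
  move=> x y xD yD exy; case: (ltngtP (enum_rank x) (enum_rank y)) => [|rk|/ord_inj/enum_rank_inj exy'].
  - exact: H.
  - have [||||c [c' [hcc l1 l2]]] := H y x => //; first by rewrite eS.
    by exists c', c; split=> //; rewrite hS.
  - by rewrite exy' eI in exy.
move=> xD yD exy rk.
(* At time [3 * n] the walk from [x] is in a first quarter of [y]. The first such time and the one
   before it give the two adjacent cells. *)
have ex_k : exists k, small y (w x y k).
  by exists (3 * n); rewrite w3 //; apply/smallP; exists x, n.
case: (ex_minnP ex_k) => k sk mk.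
have k3 : k <= 3 * n by apply: mk; rewrite w3 //; apply/smallP; exists x, n.
have nxy : x != y by apply: contraTneq rk => ->; rewrite ltnn.
case: k sk mk k3 => [|k] sk mk k3.
  by case/eqP: nxy; apply: (cls_inj x y (w x y 0)) => //; rewrite /cls ?sk // (w2 x y x) // small0.
have stk : stop x y k.
  by apply/forallP => j; apply/negP => /mk; have := ltn_ord j; lia.
have cx : cls x (w x y k) by apply/orP; right; apply/longP; exists y, k.
have cy : cls y (w x y k.+1) by rewrite /cls sk.
exists (w x y k), (w x y k.+1); rewrite (labP _ x) // (labP _ y) //; split => //.
case: (w1 x y k xD k3) => // E; case/eqP: nxy; apply: (cls_inj x y (w x y k)) => //.
by rewrite E.
Qed.

(** * Recursive separation *)

Lemma sum_card_fibers (V : finType) (B : {set V}) (f : V -> V) :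
  \sum_r #|[set x in B | f x == r]| = #|B|.
Proof.
rewrite -[in RHS]sum1_card [in RHS](partition_big f xpredT) //=; apply: eq_bigr => r _.
by rewrite -sum1_card; apply: eq_bigl => x; rewrite inE.
Qed.

(** One level of the recursion attaches all of [A] to at most four paths, at a cost of 4 (1 + #|A|),
    which is at most 8 #|A|. The components left share out at most #|A| terminals and each has at
    most half of them, so the logarithm counts the levels. *)
Lemma separator_cover (V : finType) (g : rel V) (P : V -> {set V}) (U : {set V}) :
  symmetric g -> (forall a, a \in U -> a \in P a) ->
  (forall A : {set V}, A \subset U -> exists s : seq V,
     [/\ size s <= 4, {subset s <= U} & forall x, let S := (\bigcup_(a <- s) P a)%SET in
        x \notin S -> 2 * #|A :&: component g S x| <= #|A|]) ->
  forall A : {set V}, A \subset U -> exists L : seq (V * {set V}),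
    [/\ \sum_(b <- L) (1 + #|b.2|) <= 8 * #|A| * (1 + trunc_log 2 #|A|),
        forall b, b \in L -> b.1 \in U /\ b.2 \subset A &
        forall t p, t \in A -> last t p \in A -> path g t p ->
          exists b, [/\ b \in L, t \in b.2, last t p \in b.2 & has (mem (P b.1)) (t :: p)]].
Proof.
move=> gS Pin sep A; have [n] := ubnP #|A|; elim: n A => // n IH A nA AU.
(* A single terminal still needs a pair, for the walks from it to itself. *)
have [A1|A1] := leqP #|A| 1.
  have [A0|[a aA]] := set_0Vmem A.
    by exists [::]; split => //; [rewrite big_nil|move=> t p; rewrite A0 inE].
  have EA : A = [set a].
    by apply/esym/eqP; rewrite eqEcard sub1set aA cards1.
  exists [:: (a, A)]; split.
  - by rewrite big_seq1 /= EA cards1 trunc_log1.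
  - by move=> b; rewrite inE => /eqP-> /=; split => //; apply: (subsetP AU).
  - move=> t p tA lA _; exists (a, A); split; rewrite ?inE //=.
    by move: tA; rewrite EA inE => /eqP->; rewrite Pin // (subsetP AU).
have [s [s4 sU bal]] := sep A AU.
set S := (\bigcup_(a <- s) P a)%SET in bal.
pose rr := fingraph.root (restr g (fun v => v \notin S)).
pose B := A :\: S.
pose Ar r := [set x in B | rr x == r].
have cS := connect_restr_sym (fun v => v \notin S) gS.
have half r : 2 * #|Ar r| <= #|A|.
  have [->|[x]] := set_0Vmem (Ar r); first by rewrite cards0.
  rewrite !inE => /andP[/andP[xS xA] /eqP rx].
  apply: leq_trans (bal x xS); rewrite leq_mul2l /=; apply: subset_leq_card.
  apply/subsetP => y; rewrite !inE => /andP[/andP[yS ->] ry] /=.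
  by rewrite -(root_connect cS) -/rr (eqP ry) -rx.
have ArA r : Ar r \subset A by apply/subsetP => y; rewrite !inE => /andP[/andP[_ ->]].
have small r : #|Ar r| < n by have := half r; lia.
have exf r := IH (Ar r) (small r) (subset_trans (ArA r) AU).
have /fin_all_exists[f fP] := exf; clear exf.
exists ([seq (a, A) | a <- s] ++ flatten [seq f r | r <- enum V]); split.
  rewrite big_cat /= big_map /= big_const_seq count_predT iter_addn_0.
  rewrite big_flatten /= big_map big_enum /=.
  (* Halving lowers the logarithm by one, which pays for the current level. Where [Ar r] is empty
     the bound is 0. *)
  have le_r r : \sum_(b <- f r) (1 + #|b.2|) <= 8 * trunc_log 2 #|A| * #|Ar r|.
    have [h _ _] := fP r; apply: leq_trans h _.
    have [->|r0] := posnP #|Ar r|; first by rewrite !muln0.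
    suff : 1 + trunc_log 2 #|Ar r| <= trunc_log 2 #|A| by nia.
    rewrite add1n -trunc_log2_double //; apply: leq_trunc_log.
    by have := half r; rewrite mul2n.
  have := leq_sum (P := xpredT) (index_enum V) (fun r _ => le_r r).
  rewrite -big_distrr /= sum_card_fibers => hs.
  have hB : #|B| <= #|A| by rewrite subset_leq_card // subsetDl.
  rewrite mulnDr muln1 leq_add //.
    by apply: leq_trans (leq_mul (leqnn _) s4) _; lia.
  apply: leq_trans hs _; apply: leq_trans (leq_mul (leqnn _) hB) _.
  by rewrite mulnAC.
- move=> b; rewrite mem_cat => /orP[/mapP[a ain ->]|/flattenP[l /mapP[r _ ->] bl]] /=.
    by split => //; apply: sU.
  have [_ /(_ b bl)[bU bA] _] := fP r; split => //.
  exact: subset_trans bA (ArA r).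
(* A walk meeting [S] meets a path chosen at this level; any other stays in one component and is
   left to the recursion. *)
- move=> t p tA lA pp; have [hS|nS] := boolP (has (mem S) (t :: p)).
    case/hasP: hS => y yp /= yS.
    have [a as_ ya] : exists2 a, a \in s & y \in P a.
      move: yS; rewrite /S; elim: (s) => [|a s' IHs]; first by rewrite big_nil inE.
      rewrite big_cons inE => /orP[ya|/IHs[a' a's' ya']]; first by exists a; rewrite ?mem_head.
      by exists a'; rewrite // inE a's' orbT.
    have hh : has (mem (P a)) (t :: p) by apply/hasP; exists y.
    by exists (a, A); split => //; rewrite mem_cat map_f.
  have conn : connect (restr g (fun v => v \notin S)) t (last t p).
    apply/connectP; exists p => //; elim: p t {tA lA} pp nS => //= y p IHp t /andP[ty yp].
    rewrite !negb_or => /and3P[tS yS pS]; rewrite {1}/restr /= ty tS yS /=.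
    by apply: IHp => //=; rewrite negb_or yS.
  have tS : t \notin S by move: nS; rewrite /= negb_or => /andP[].
  have lS : last t p \notin S by have := connect_restr_mem conn tS.
  have [_ _ H] := fP (rr t).
  have [| |b [bL tb lb hb]] := H t p _ _ pp.
  + by rewrite !inE tS tA eqxx.
  + by rewrite !inE lS lA; apply/eqP/esym/fingraph.rootP.
  + exists b; split => //; rewrite mem_cat; apply/orP; right.
    by apply/flattenP; exists (f (rr t)) => //; rewrite map_f ?mem_enum.
Qed.

Require Import Defs.
From HB Require Import structures.
From mathcomp Require Import all_boot all_order all_algebra.
From mathcomp Require Import all_classical all_reals all_analysis.
From mathcomp Require Import lra.

Import Order.TTheory GRing.Theory Num.Theory.
Import numFieldNormedType.Exports.

(** * Planar drawings on a grid *)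

Lemma adj_sym (V : finType) (G : graph V) : symmetric (adj G).
Proof. by move=> x y; rewrite /adj finset.setUC. Qed.

Lemma adj_verts (V : finType) (G : graph V) x y :
  adj G x y -> [/\ x \in verts G, y \in verts G & x != y].
Proof.
move=> /edges_wf[c2 /fintype.subsetP sG]; split.
- by apply: sG; rewrite !inE eqxx.
- by apply: sG; rewrite !inE eqxx orbT.
- by move: c2; rewrite cards2; case: eqP.
Qed.

Lemma set2_inj (V : finType) (x y u w : V) :
  [set x; y]%SET = [set u; w]%SET -> (x = u /\ y = w) \/ (x = w /\ y = u).
Proof.
move=> /setP E; have := (E x, E y, E u, E w); rewrite !inE !eqxx ?orbT /=.
case=> [[[/esym/orP h1 /esym/orP h2] /orP h3] /orP h4].
case: h1 => /eqP h1; [left|right]; split=> //.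
  by case: h2 => /eqP h2 //; case: h4 => /eqP h4; congruence.
by case: h2 => /eqP h2 //; case: h3 => /eqP h3; congruence.
Qed.

Local Open Scope ring_scope.

(** Compactness of the segment, in a form that gives uniform continuity, positive distances and
    bounds alike: a property that persists for smaller [d] and holds near each point for some [d]
    holds everywhere for one [d]. *)
Lemma segment_uniform (R : realType) (b : R) (P : R -> R -> Prop) :
  (forall d d' s, 0 < d' -> d' <= d -> P d s -> P d' s) ->
  (forall s, 0 <= s <= b -> exists2 d, 0 < d &
     forall s', 0 <= s' <= b -> `|s - s'| < d -> P d s') ->
  exists2 d, 0 < d & forall s, 0 <= s <= b -> P d s.
Proof.
move=> mP locP.
have nc := (compact_near_coveringP _).1 (@segment_compact R 0 b).
have H := nc R (at_right (0:R)) (fun d s => 0 <= s <= b -> P d s) _.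
have : (\forall d \near at_right (0:R), (`[0, b] `<=` (fun s => 0 <= s <= b -> P d s))%classic).
  apply: H => s; rewrite /= in_itv /= => /locP[d d0 dP].
  exists ((ball s d), [set e | 0 < e <= d])%classic.
    split => /=; first exact: nbhsx_ballx.
    by exists d => //= e /=; rewrite sub0r normrN => ed e0; rewrite e0; apply: ltW; apply: le_lt_trans ed; rewrite ler_norm.
  case=> s' e /= [ss' /andP[e0 ed]] s'b; apply: mP e0 ed _.
  exact: dP.
case=> d /= d0 dH.
have d20 : 0 < d / 2 by lra.
exists (d / 2) => // s sb; apply: (dH (d / 2)) => //=.
  by rewrite sub0r normrN gtr0_norm //; lra.
Qed.

Lemma within_continuous_dist (R : realType) (f : R -> R * R) (b : R) :
  {within `[0, b], continuous f}%classic ->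
  forall s e, 0 <= s <= b -> 0 < e -> exists2 d, 0 < d &
    forall s', 0 <= s' <= b -> `|s - s'| < d -> `|f s - f s'| < e.
Proof.
move=> /subspace_continuousP cf s e sb e0.
have := cf s; rewrite /= in_itv /= => /(_ sb).
move=> /cvgrPdist_lt /(_ e e0).
rewrite /prop_near1 /within /= => /nbhs_ballP[d /= d0 dH]; exists d => // s' s'b ds.
by apply: (dH s'); rewrite //= in_itv.
Qed.

Lemma within_continuous_rev (R : realType) (f : R -> R * R) (b : R) :
  {within `[0, b], continuous f}%classic ->
  {within `[0, b], continuous (fun s => f (b - s))}%classic.
Proof.
move=> /within_continuous_dist cf; apply/subspace_continuousP => s /=.
rewrite in_itv /= => sb; apply/cvgrPdist_lt => e e0.
have [|d d0 dP] := cf (b - s) e _ e0; first by lra.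
rewrite /prop_near1 /within /=; apply/nbhs_ballP; exists d => // s' /= ss'.
rewrite in_itv /= => s'b; apply: dP; first by lra.
by rewrite opprB addrC addrA subrK distrC.
Qed.

Lemma segment_uniform_continuous (R : realType) (f : R -> R * R) (b e : R) :
  {within `[0, b], continuous f}%classic -> 0 < e ->
  exists2 d, 0 < d & forall s s', 0 <= s <= b -> 0 <= s' <= b ->
    `|s - s'| < d -> `|f s - f s'| < e.
Proof.
move=> /within_continuous_dist cf e0.
have [|s sb|d d0 dP] := @segment_uniform R b (fun d s => forall s', 0 <= s' <= b ->
    `|s - s'| < d -> `|f s - f s'| < e).
- by move=> d d' s d'0 dd' Pd s' s'b ss'; apply: Pd => //; apply: lt_le_trans dd'.
- have e20 : 0 < e / 2 by lra.
  have [d d0 dP] := cf s (e / 2) sb e20.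
  exists (d / 2); first by lra.
  move=> s1 s1b ss1 s' s'b s1s'.
  have h1 : `|f s - f s1| < e / 2 by apply: dP => //; lra.
  have h2 : `|f s - f s'| < e / 2.
    by apply: dP => //; apply: le_lt_trans (ler_distD s1 _ _) _; lra.
  apply: le_lt_trans (ler_distD (f s) _ _) _; rewrite [`|f s1 - _|]distrC; lra.
- by exists d => // s s' sb s'b; apply: dP.
Qed.

(** Compactness is applied twice, to [s'] for a fixed [s] and then to [s]. Halving the distance at a
    point leaves room for nearby parameters. *)
Lemma segment_dist_lb (R : realType) (f g : R -> R * R) (b : R) :
  {within `[0, b], continuous f}%classic -> {within `[0, b], continuous g}%classic ->
  (forall s s', 0 <= s <= b -> 0 <= s' <= b -> f s <> g s') ->
  exists2 d, 0 < d & forall s s', 0 <= s <= b -> 0 <= s' <= b -> d <= `|f s - g s'|.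
Proof.
move=> /within_continuous_dist cf /within_continuous_dist cg fg.
have [|s sb|d d0 dP] := @segment_uniform R b (fun d s => forall s', 0 <= s' <= b ->
    d <= `|f s - g s'|).
- by move=> d d' s d'0 dd' Pd s' s'b; apply: le_trans dd' _; apply: Pd.
- have [|s1 s1b|d d0 dP] := @segment_uniform R b (fun d s' => d <= `|f s - g s'|).
  + by move=> d d' s' d'0 dd'; apply: le_trans.
  + have n0 : 0 < `|f s - g s1|.
      by rewrite normr_gt0 subr_eq0; apply/eqP/fg.
    have [|d d0 dP] := cg s1 (`|f s - g s1| / 2) s1b; first by lra.
    exists (Num.min d (`|f s - g s1| / 2)); first by rewrite lt_min d0; lra.
    move=> s' s'b; rewrite lt_min => /andP[h1 _]; rewrite ge_min; apply/orP; right.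
    have := dP s' s'b h1; have := ler_distD (g s') (f s) (g s1).
    rewrite [`|g s' - _|]distrC; lra.
  have [|d' d'0 d'P] := cf s (d / 2) sb; first by lra.
  exists (Num.min d' (d / 2)); first by rewrite lt_min d'0; lra.
  move=> s1 s1b; rewrite lt_min => /andP[h1 _] s' s'b; rewrite ge_min; apply/orP; right.
  have := d'P s1 s1b h1; have := dP s' s'b; have := ler_distD (f s1) (f s) (g s'); lra.
- by exists d => // s s' sb s'b; apply: dP.
Qed.

Lemma segment_bounded (R : realType) (f : R -> R * R) (b : R) :
  {within `[0, b], continuous f}%classic ->
  exists2 L, 0 < L & forall s, 0 <= s <= b -> `|f s| < L.
Proof.
move=> /within_continuous_dist cf.
(* The bound is written as an inverse so that it weakens as [d] shrinks. *)
have [|s sb|d d0 dP] := @segment_uniform R b (fun d s => `|f s| < d^-1).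
- move=> d d' s d'0 dd' h; apply: lt_le_trans h _.
  by rewrite lef_pV2 // posrE; lra.
- have [|d d0 dP] := cf s 1 sb; first by lra.
  have n0 := normr_ge0 (f s).
  have i0 : 0 < (`|f s| + 1)^-1 by rewrite invr_gt0; lra.
  exists (Num.min d (`|f s| + 1)^-1); first by rewrite lt_min d0.
  move=> s1 s1b; rewrite lt_min => /andP[h1 _].
  have h : `|f s1| < `|f s| + 1.
    by have := dP _ s1b h1; have := lerB_dist (f s1) (f s); rewrite [`|f s1 - _|]distrC; lra.
  apply: lt_le_trans h _; rewrite -[X in X <= _]invrK lef_pV2 ?posrE //.
  + by rewrite ge_min lexx orbT.
  + by rewrite lt_min d0 i0.
- by exists d^-1; rewrite ?invr_gt0.
Qed.

(* [a v u] runs through the arc of the edge [v u] starting at [v]; it is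
   constant, at the point [v], when there is no such edge. *)
Lemma planar_oriented_arcs (R : realType) (V : finType) (G : graph V) :
  planar R G -> exists a : V -> V -> R -> R * R,
  [/\ forall v u, {within `[0, 1], continuous (a v u)}%classic,
      forall v u u', v \in verts G -> a v u 0 = a v u' 0,
      forall v u s, adj G v u -> a u v s = a v u (1 - s) &
      forall v u v' u' s s', v \in verts G -> v' \in verts G -> v <> v' ->
        0 <= s < 1 -> 0 <= s' < 1 ->
        ([set v; u]%SET <> [set v'; u']%SET \/ s + s' < 1) ->
        a v u s <> a v' u' s'].
Proof.
case=> pos [arc [posI arcP arcV arcE]].
pose a v u s := if adj G v u then
  (if arc [set v; u]%SET 0 == pos v then arc [set v; u]%SET s else arc [set v; u]%SET (1 - s))
  else pos v.
have adjP v u : adj G v u -> 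
   (arc [set v; u]%SET 0 = pos v /\ arc [set v; u]%SET 1 = pos u) \/
   (arc [set v; u]%SET 1 = pos v /\ arc [set v; u]%SET 0 = pos u).
  move=> /arcP[_ _ [x [y [/set2_inj[] [-> ->]]]]] h0 h1; [by left|by right].
have adjN v u : adj G v u -> pos v <> pos u.
  by case/adj_verts => vG uG /eqP vu /(posI _ _ vG uG).
have a0 v u : v \in verts G -> a v u 0 = pos v.
  move=> vG; rewrite /a; case: ifP => // vu; case: ifP => [/eqP //|/eqP n0].
  by rewrite subr0; case: (adjP _ _ vu) => [[]|[]].
have a_int v u s : adj G v u -> 0 < s < 1 -> exists2 s', s' \in `]0, 1[ & a v u s = arc [set v; u]%SET s'.
  move=> vu s01; rewrite /a vu; case: ifP => _.
    by exists s; rewrite ?in_itv.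
  by exists (1 - s); rewrite ?in_itv //=; lra.
have arev v u s : adj G v u -> a u v s = a v u (1 - s).
  move=> vu; rewrite /a vu (adj_sym G u v) vu (finset.setUC [set u]%SET).
  have := adjN _ _ vu; case: (adjP _ _ vu) => [[-> _]|[_ ->]] /eqP vu'.
    by rewrite (negbTE vu') eqxx.
  by rewrite eqxx eq_sym (negbTE vu') opprB addrCA subrr addr0.
have ainj v u s s' : adj G v u -> 0 <= s <= 1 -> 0 <= s' <= 1 -> a v u s = a v u s' -> s = s'.
  move=> vu sb s'b; rewrite /a vu; have [_ inj _] := arcP _ vu.
  case: ifP => _ /inj; rewrite !in_itv /=; first exact.
  by move=> h; have : 1 - s = 1 - s' by [apply: h; lra]; lra.
exists a; split => //.
- move=> v u; have [vu|nvu] := boolP (adj G v u); last first.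
    have -> : a v u = (fun=> pos v) by apply/funext => s; rewrite /a (negbTE nvu).
    by apply: continuous_subspaceT => x; apply: cst_continuous.
  have [cf _ _] := arcP _ vu; case: (eqVneq (arc [set v; u]%SET 0) (pos v)) => [e0|n0].
    suff -> : a v u = arc [set v; u]%SET by [].
    by apply/funext => s; rewrite /a vu e0 eqxx.
  suff -> : a v u = (fun s => arc [set v; u]%SET (1 - s)) by exact: within_continuous_rev.
  by apply/funext => s; rewrite /a vu (negbTE n0).
- by move=> v u u' vG; rewrite !a0.
move=> v u v' u' s s' vG v'G vv' sb s'b hd.
have cases w z r : w \in verts G -> 0 <= r < 1 -> a w z r = pos w \/ (adj G w z /\ 0 < r < 1).
  move=> wG /andP[r0 r1]; have [wz|nwz] := boolP (adj G w z); last first.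
    by left; rewrite /a (negbTE nwz).
  case: (ltrgtP 0 r) r0 => // [r0 _|<- _]; first by right.
  by left; apply: a0.
have edge_pos w z r x : adj G w z -> 0 < r < 1 -> x \in verts G -> a w z r <> pos x.
  by move=> wz r01 xG; have [r' r'b ->] := a_int _ _ _ wz r01; apply: arcV.
case: (cases v u s vG sb) => [->|[vu s01]]; case: (cases v' u' s' v'G s'b) => [->|[vu' s'01]].
- by move=> /(posI _ _ vG v'G).
- by move=> /esym; apply: edge_pos.
- exact: edge_pos.
have [e|/eqP ne] := eqVneq [set v; u]%SET [set v'; u']%SET; last first.
  have [r rb ->] := a_int _ _ _ vu s01; have [r' r'b ->] := a_int _ _ _ vu' s'01.
  exact: arcE.
(* The same edge is run from both ends, so a common point would force [s + s' = 1]. *)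
case: hd => // ss; case: (set2_inj e) => [[/vv' //]|[vu1 uv1]].
rewrite -vu1 -uv1 (arev v u s') // => /ainj h; have : s = 1 - s' by apply: h => //; lra.
lra.
Qed.

Lemma fin_uniform (R : realType) (T : finType) (P : T -> R -> Prop) :
  (forall t d d', 0 < d' -> d' <= d -> P t d -> P t d') ->
  (forall t, exists2 d, 0 < d & P t d) ->
  exists2 d, 0 < d & forall t, P t d.
Proof.
move=> mP exP; have /choice[f f0] : forall t, exists d, 0 < d /\ P t d.
  by move=> t; have [d] := exP t; exists d.
exists (\big[Num.min/1]_t f t).
  by apply: lt_bigmin => // t _; have [] := f0 t.
move=> t; have [ft0 Pft] := f0 t; apply: mP Pft.
  by apply: lt_bigmin => // t' _; have [] := f0 t'.
exact: bigmin_le.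
Qed.

Section Coordinates.
Context (R : realType) (L h : R) (h0 : 0 < h).

(** The successor keeps the coordinate 0 free, so that the drawing avoids the boundary of the
    grid. *)
Definition grid_coord (x : R) : nat := (Num.truncn ((x + L) / h)).+1.

Lemma grid_coord_itv x : - L <= x ->
  ((grid_coord x)%:R - 1) * h <= x + L < (grid_coord x)%:R * h.
Proof.
move=> xL; have := @truncn_itv _ ((x + L) / h).
rewrite divr_ge0 ?(ltW h0) //; last by lra.
move=> /(_ isT); rewrite ler_pdivlMr // ltr_pdivrMr // /grid_coord.
by rewrite -[X in X - 1]natr1 addrK.
Qed.

Lemma grid_coord_inj x y : - L <= x -> - L <= y ->
  grid_coord x = grid_coord y -> `|x - y| < h.
Proof.
move=> /grid_coord_itv hx /grid_coord_itv hy e; rewrite e in hx.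
rewrite ltr_norml; nra.
Qed.

Lemma grid_coord_step x y : - L <= x -> - L <= y -> `|x - y| < h ->
  [\/ grid_coord x = grid_coord y, (grid_coord x).+1 = grid_coord y | (grid_coord y).+1 = grid_coord x].
Proof.
move=> /grid_coord_itv hx /grid_coord_itv hy; rewrite ltr_norml => xy.
have aux m n (a b : R) : (m%:R - 1) * h <= a < m%:R * h -> (n%:R - 1) * h <= b < n%:R * h ->
    a - b < h -> (m < n.+2)%N.
  move=> ha hb ab; rewrite ltnNge; apply/negP => le.
  have : (n.+2%:R : R) <= m%:R by rewrite ler_nat.
  rewrite -!natr1 => le'; nra.
have h1 := aux _ _ _ _ hx hy.
have h2 := aux _ _ _ _ hy hx.
have {}h1 : (grid_coord x < (grid_coord y).+2)%N by apply: h1; lra.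
have {}h2 : (grid_coord y < (grid_coord x).+2)%N by apply: h2; lra.
case: (ltngtP (grid_coord x) (grid_coord y)) => c; [constructor 2|constructor 3|by constructor 1]; lia.
Qed.

Lemma grid_coord_bound x : `|x| < L ->
  (0 < grid_coord x < (Num.truncn (2 * L / h)).+2)%N.
Proof.
rewrite ltr_norml => xL; rewrite /grid_coord !ltnS /=.
apply: le_truncn; rewrite ler_pM2r ?invr_gt0 //; lra.
Qed.
End Coordinates.

Lemma pair_norm_coord (R : realType) (p : R * R) : `|p.1| <= `|p| /\ `|p.2| <= `|p|.
Proof. by rewrite prod_normE /=; split; rewrite le_max lexx ?orbT. Qed.

(** Each arc is traced by a walk of cells on a mesh so fine that arcs at positive distance never
    share a cell. First quarters from different vertices are at positive distance, and so are first
    three quarters from different vertices on different pairs; this is what [walks_labelling]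
    requires. *)
Lemma planar_grid_labelling (R : realType) (V : finType) (G : graph V) (D : {set V}) :
  planar R G -> D \subset verts G ->
  exists N (lab : cell N -> option V),
  [/\ forall c v, lab c = Some v -> v \in D /\ ~~ boundary c,
      forall v, connected_classes (@gadj N) lab (Some v),
      forall v, v \in D -> exists c, lab c = Some v &
      forall x y, x \in D -> y \in D -> adj G x y ->
        exists c c', [/\ gadj c c', lab c = Some x & lab c' = Some y]].
Proof.
case/planar_oriented_arcs => a [ac a0 arev asep] /fintype.subsetP DG.
have acb b v u : b <= 1 -> {within `[0, b], continuous (a v u)}%classic.
  move=> b1; apply: continuous_subspaceW (ac v u) => s /=; rewrite !in_itv /= => /andP[-> sb].
  exact: le_trans sb b1.
pose sep (b : R) (q : V * V * (V * V)) (d : R) := forall s s', 0 <= s <= b -> 0 <= s' <= b ->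
  d <= `|a q.1.1 q.1.2 s - a q.2.1 q.2.2 s'|.
pose distinct (q : V * V * (V * V)) := [&& q.1.1 \in D, q.2.1 \in D & q.1.1 != q.2.1].
have sepW b q d d' : d' <= d -> sep b q d -> sep b q d'.
  by move=> dd' hd s s' sb s'b; apply: le_trans dd' _; apply: hd.
have [d1 d10 sep1] : exists2 d, 0 < d & forall q, distinct q -> sep (1/4) q d.
  apply: fin_uniform => [q d d' _ dd' hq dq|[[v u] [v' u']]]; first exact: sepW (hq dq).
  have [/and3P[/= vD v'D vv']|nd] := boolP (distinct (v, u, (v', u'))); last by exists 1 => //; rewrite (negbTE nd).
  have [||s s' sb s'b|d d0 hd] := @segment_dist_lb R (a v u) (a v' u') (1/4).
  - by apply: acb; lra.
  - by apply: acb; lra.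
  - apply: asep; [exact: DG|exact: DG|exact/eqP|lra|lra|right; lra].
  - by exists d.
have [d2 d20 sep2] : exists2 d, 0 < d & forall q, distinct q ->
    [set q.1.1; q.1.2]%SET != [set q.2.1; q.2.2]%SET -> sep (3/4) q d.
  apply: fin_uniform => [q d d' _ dd' hq dq nq|[[v u] [v' u']]]; first exact: sepW (hq dq nq).
  have [/and3P[/= vD v'D vv']|nd] := boolP (distinct (v, u, (v', u'))); last by exists 1 => //; rewrite (negbTE nd).
  have [e|/eqP ne] := eqVneq [set v; u]%SET [set v'; u']%SET.
    by exists 1 => // _ /=; rewrite e eqxx.
  have [||s s' sb s'b|d d0 hd] := @segment_dist_lb R (a v u) (a v' u') (3/4).
  - by apply: acb; lra.
  - by apply: acb; lra.
  - apply: asep; [exact: DG|exact: DG|exact/eqP|lra|lra|by left].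
  - by exists d.
have [Li Li0 bound] : exists2 L, 0 < L & forall q : V * V, forall s, 0 <= s <= 1 -> `|a q.1 q.2 s| < L^-1.
  apply: fin_uniform => [q d d' d'0 dd' hq s sb|[v u]].
    by apply: lt_le_trans (hq s sb) _; rewrite lef_pV2 // posrE //; lra.
  have [L L0 hL] := segment_bounded (ac v u).
  by exists L^-1; rewrite ?invr_gt0 // => s sb; rewrite invrK hL.
set L := Li^-1 in bound.
(* Traced points in one cell are within [h] of each other, and each is within [h] of its arc, whence
   the 3. *)
pose h := Num.min d1 d2 / 3.
have h0 : 0 < h by rewrite divr_gt0 // lt_min d10.
have h1 : 3 * h <= d1.
  have : Num.min d1 d2 <= d1 by rewrite ge_min lexx.
  by rewrite /h; lra.
have h2 : 3 * h <= d2.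
  have : Num.min d1 d2 <= d2 by rewrite ge_min lexx orbT.
  by rewrite /h; lra.
have [d d0 uc] : exists2 d, 0 < d & forall q : V * V, forall s s', 0 <= s <= 1 -> 0 <= s' <= 1 ->
    `|s - s'| < d -> `|a q.1 q.2 s - a q.1 q.2 s'| < h.
  apply: fin_uniform => [q d d' d'0 dd' hq s s' sb s'b ss'|[v u]].
    by apply: hq => //; apply: lt_le_trans dd'.
  exact: segment_uniform_continuous.
have [m [m0 md]] : exists m : nat, (0 : R) < m%:R /\ (m%:R)^-1 < d.
  exists (Num.truncn d^-1).+1; rewrite ltr0n; split => //.
  by rewrite -[X in _ < X]invrK ltf_pV2 ?posrE ?invr_gt0 // truncnS_gt.
pose t (i : nat) : R := i%:R / (4 * m%:R).
have tE i : t i * (4 * m%:R) = i%:R by rewrite /t mulfVK //; lra.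
have t0 i : 0 <= t i by rewrite divr_ge0 //; lra.
have t_le i j : (i <= j * m)%N -> t i <= j%:R / 4.
  rewrite -(ler_nat R) natrM => ij; have := tE i; nra.
have tS i : `|t i.+1 - t i| < d.
  have -> : t i.+1 - t i = (m%:R)^-1 / 4 by rewrite /t -mulrBl -natr1 addrAC subrr add0r mul1r invfM mulrC.
  by rewrite ger0_norm ?divr_ge0 ?invr_ge0 //; lra.
(* The coordinates advance alternately, so that consecutive cells are equal or share a side and no
   diagonal step occurs. *)
pose pt v u k : R * R := ((a v u (t (uphalf k))).1, (a v u (t k./2)).2).
have ptb v u k : (k <= 8 * m)%N -> `|(pt v u k).1| < L /\ `|(pt v u k).2| < L.
  move=> km; have aux i : (i <= 4 * m)%N -> 0 <= t i <= 1.
    by move=> /t_le ti; rewrite t0 /=; lra.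
  have [c1 _] := pair_norm_coord (a v u (t (uphalf k))).
  have [_ c2] := pair_norm_coord (a v u (t k./2)).
  split; [apply: le_lt_trans c1 _|apply: le_lt_trans c2 _]; apply: (bound (v, u)); apply: aux;
   rewrite ?uphalf_half; clear -km; lia.
pose N := (Num.truncn (2 * L / h)).+2.
pose co := grid_coord L h.
pose w v u k : cell N := (inord (co (pt v u k).1), inord (co (pt v u k).2)).
have coN x : `|x| < L -> (0 < co x < N)%N by exact: grid_coord_bound.
have LL x : `|x| < L -> - L <= x by rewrite ltr_norml => /andP[/ltW].
have wE v u k : (k <= 8 * m)%N ->
   (w v u k).1 = co (pt v u k).1 :> nat /\ (w v u k).2 = co (pt v u k).2 :> nat.
  move=> km; have [b1 b2] := ptb v u k km.
  by split; rewrite inordK //; [have := coN _ b1|have := coN _ b2] => /andP[_ /ltnW].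
have pt_near v u k : (k <= 6 * m)%N -> `|pt v u k - a v u (t k./2)| < h.
  move=> km; rewrite prod_normE /= subrr normr0 gt_max h0 andbT.
  have [c1 _] := pair_norm_coord (a v u (t (uphalf k)) - a v u (t k./2)).
  apply: le_lt_trans c1 _; apply: (uc (v, u)).
  - by rewrite t0; apply: le_trans (@t_le _ 4 _) _; [rewrite uphalf_half; clear -km; lia|lra].
  - by rewrite t0; apply: le_trans (@t_le _ 4 _) _; [clear -km; lia|lra].
  - by rewrite uphalf_half; case: (odd k); rewrite ?add1n ?add0n ?subrr ?normr0.
(* A quarter of an arc takes [m] time steps, and each time step is two steps of the walk. *)
have [|||||||lab [l1 l2 l3 l4]] := @walks_labelling (cell N) V (@gadj N) (adj G) D w (2 * m).
- exact: gadj_sym.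
- exact: adj_sym.
- by move=> x; apply/negP => /adj_verts[_ _ /eqP].
- move=> v u k vD km.
  have km8 : (k <= 8 * m)%N by clear -km; lia.
  have km8' : (k.+1 <= 8 * m)%N by clear -km; lia.
  have [e1 e2] := wE v u k km8; have [e1' e2'] := wE v u k.+1 km8'.
  have [b1 b2] := ptb v u k km8; have [b1' b2'] := ptb v u k.+1 km8'.
  have near1 : `|a v u (t k./2) - a v u (t k./2.+1)| < h.
    apply: (uc (v, u)).
    - by rewrite t0; apply: le_trans (@t_le _ 4 _) _; [clear -km; lia|lra].
    - by rewrite t0; apply: le_trans (@t_le _ 4 _) _; [clear -km; lia|lra].
    - by rewrite distrC.
  have [n1 n2] := pair_norm_coord (a v u (t k./2) - a v u (t k./2.+1)).
  have [ok|ek] := boolP (odd k).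
  + have E1 : (pt v u k.+1).1 = (pt v u k).1.
      by rewrite /pt /= uphalf_half ok add1n.
    have E2 : `|(pt v u k).2 - (pt v u k.+1).2| < h.
      rewrite /pt /= uphalf_half ok add1n; exact: le_lt_trans n2 near1.
    have := grid_coord_step h0 (LL _ b2) (LL _ b2') E2; rewrite -/co -e2 -e2'.
    have : (w v u k).1 = (w v u k.+1).1 :> nat by rewrite e1 e1' E1.
    case: (w v u k) (w v u k.+1) => [i j] [i' j'] /= /ord_inj-> [/ord_inj->|jj'|jj']; first by left.
      by right; rewrite /gadj /= jj' !eqxx.
    by right; rewrite /gadj /= jj' !eqxx orbT.
  + have E1 : (pt v u k.+1).2 = (pt v u k).2.
      by rewrite /pt /= uphalf_half (negbTE ek) add0n.
    have E2 : `|(pt v u k).1 - (pt v u k.+1).1| < h.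
      rewrite /pt /= uphalf_half (negbTE ek) add0n; exact: le_lt_trans n1 near1.
    have := grid_coord_step h0 (LL _ b1) (LL _ b1') E2; rewrite -/co -e1 -e1'.
    have : (w v u k).2 = (w v u k.+1).2 :> nat by rewrite e2 e2' E1.
    case: (w v u k) (w v u k.+1) => [i j] [i' j'] /= /ord_inj-> [/ord_inj->|jj'|jj']; first by left.
      by right; rewrite /gadj /= jj' !eqxx orbT.
    by right; rewrite /gadj /= jj' !eqxx !orbT.
- move=> v u u' vD; rewrite /w /pt /= /t mul0r.
  by rewrite (a0 v u u') //; apply: DG.
- move=> x y xD yD xy; rewrite /w /pt.
  have -> : uphalf (3 * (2 * m)) = (3 * m)%N by clear; lia.
  have -> : (3 * (2 * m))./2 = (3 * m)%N by clear; lia.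
  have -> : uphalf (2 * m) = m by clear; lia.
  have -> : (2 * m)./2 = m by clear; lia.
  rewrite (arev x y (t m)) //; have -> : 1 - t m = t (3 * m)%N; last by [].
  by have := tE m; have := tE (3 * m)%N; rewrite natrM; nra.
- move=> v u v' u' k k' vD v'D nv hk E.
  have km : (k <= 6 * m)%N by clear -hk; lia.
  have km' : (k' <= 6 * m)%N by clear -hk; lia.
  have km8 : (k <= 8 * m)%N by clear -km; lia.
  have km8' : (k' <= 8 * m)%N by clear -km'; lia.
  have [e1 e2] := wE v u k km8; have [e1' e2'] := wE v' u' k' km8'.
  have [b1 b2] := ptb v u k km8; have [b1' b2'] := ptb v' u' k' km8'.
  have c1 : `|pt v u k - pt v' u' k'| < h.
    rewrite prod_normE /= gt_max; apply/andP; split.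
      by apply: (grid_coord_inj h0 (LL _ b1) (LL _ b1')); rewrite -/co -e1 -e1' E.
    by apply: (grid_coord_inj h0 (LL _ b2) (LL _ b2')); rewrite -/co -e2 -e2' E.
  have c2 := pt_near v u k km; have c3 := pt_near v' u' k' km'.
  have close : `|a v u (t k./2) - a v' u' (t k'./2)| < 3 * h.
    have := ler_distD (pt v u k) (a v u (t k./2)) (a v' u' (t k'./2)).
    have := ler_distD (pt v' u' k') (pt v u k) (a v' u' (t k'./2)).
    by rewrite [`|_ - pt v u k|]distrC; lra.
  have dist_q : distinct (v, u, (v', u')) by rewrite /distinct /= vD v'D nv.
  case: hk => [[kn kn']|[ne [kn kn']]].
    have := sep1 _ dist_q (t k./2) (t k'./2); rewrite !t0 /=.
    have -> : t k./2 <= 1 / 4 by apply: (@t_le _ 1); clear -kn; lia.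
    have -> : t k'./2 <= 1 / 4 by apply: (@t_le _ 1); clear -kn'; lia.
    by move=> /(_ isT isT); lra.
  have := sep2 _ dist_q ne (t k./2) (t k'./2); rewrite !t0 /=.
  have -> : t k./2 <= 3 / 4 by apply: (@t_le _ 3); clear -kn; lia.
  have -> : t k'./2 <= 3 / 4 by apply: (@t_le _ 3); clear -kn'; lia.
  by move=> /(_ isT isT); lra.
exists N, lab; split => // c v /l1[vD [u [k [km ->]]]]; split => //.
have km8 : (k <= 8 * m)%N by clear -km; lia.
have [e1 e2] := wE v u k km8; have [b1 b2] := ptb v u k km8.
rewrite /boundary e1 e2; move: (coN _ b1) (coN _ b2) => /andP[i0 iN] /andP[j0 jN].
by rewrite (gtn_eqF i0) (gtn_eqF j0) (ltn_eqF iN) (ltn_eqF jN).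
Qed.

Local Close Scope ring_scope.

Lemma component_whole (V : finType) (g : rel V) x y :
  (y \in component g finset.set0 x) = connect g x y.
Proof.
rewrite inE; apply: eq_connect => u v.
by rewrite /restr /= !inE !andbT.
Qed.

Lemma component_subset (V : finType) (g : rel V) (S : {set V}) x :
  component g S x \subset component g finset.set0 x.
Proof.
by apply/fintype.subsetP => y; rewrite !inE; apply: connect_restrW => v; rewrite inE.
Qed.

(** At most one component of [G] holds more than half of [A]. If there is one, it alone is put on
    the grid, so that all labels share a root. *)
Lemma planar_separator (R : realType) (V : finType) (G : graph V)
    (P : V -> {set V}) (rt : V -> V) (A : {set V}) :
  planar R G -> A \subset verts G ->
  (forall a, a \in verts G -> a \in P a) ->
  (forall a, a \in verts G -> connect (restr (adj G) (mem (P a))) a (rt a)) ->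
  (forall a b, connect (adj G) a b -> rt a = rt b) ->
  exists s : seq V, [/\ size s <= 4, {subset s <= verts G} &
    forall x, let S := (\bigcup_(a <- s) P a)%SET in
      x \notin S -> 2 * #|A :&: component (adj G) S x| <= #|A|].
Proof.
move=> plG AG Pin Pc Prt.
have gS := @adj_sym V G.
have cS : connect_sym (adj G) by exact: sym_connect_sym.
have [bal|] := boolP [forall x, 2 * #|A :&: component (adj G) finset.set0 x| <= #|A|].
  by exists [::]; split => // x; rewrite big_nil => /= _; apply: (forallP bal).
rewrite negb_forall => /existsP[x0]; rewrite -ltnNge => heavy.
(* The witness [x0] is not known to be a vertex of [G]; an element of [A] in its component is. *)
have /set0Pn[y] : A :&: component (adj G) finset.set0 x0 != finset.set0.
  by apply: contraL heavy => /eqP->; rewrite cards0.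
rewrite inE component_whole => /andP[yA x0y].
set D := component (adj G) finset.set0 x0 in heavy.
have DE v : (v \in D) = connect (adj G) y v by rewrite component_whole; apply: same_connect.
have yG : y \in verts G by apply: (fintype.subsetP AG).
have DG : D \subset verts G.
  apply/fintype.subsetP => v; rewrite DE => /connectP[p]; elim: p y yG {yA x0y DE} => [|z p IH] y yG /=.
    by move=> _ ->.
  by case/andP=> /adj_verts[_ zG _]; apply: IH.
have Dcl x z : x \in D -> adj G x z -> z \in D.
  by rewrite !DE => yx xz; apply: connect_trans yx (connect1 xz).
have [N [lab0 [l1 l2 l3 l4]]] := planar_grid_labelling plG DG.
have [c0 lc0] := l3 y (etrans (DE y) (connect0 _ _)).
have [||||||lab [ext im cl bd]] := @extend_labelling (cell N) V (@gadj N) lab0 (@boundary N) c0 y => //.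
- exact: gadj_sym.
- exact: grid_connected.
- by move=> c bc; case E : (lab0 c) => [v|//]; have [_] := l1 _ _ E; rewrite bc.
- exact: boundary_connected.
have labD c : lab c \in D by have [c'] := im c; case/l1.
have onto v : v \in D -> exists c, lab c = v.
  by move=> /l3[c /ext]; exists c.
have [r0 lr0] : exists c, lab c = rt y.
  by apply: onto; rewrite DE; apply: connect_sub (Pc y yG) => u v /and3P[uv _ _]; apply: connect1.
have rtc c : rt (lab c) = lab r0.
  by rewrite lr0; apply: Prt; rewrite cS -DE.
have labG c : lab c \in verts G by apply: (fintype.subsetP DG).
(* Less than half of [A] lies outside [D], so it suffices to separate [A :&: D]. *)
have [||||||a [b [c [d H]]]] := @grid_separator V (adj G) N lab P r0 (A :&: D) gS.
- by move=> c c' e; apply: cl.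
- move=> c z cz; have [d [d' [dd' /ext ld /ext ld']]] := l4 _ _ (labD c) (Dcl _ _ (labD c) cz) cz.
  by exists d, d'.
- exact: bd.
- by move=> c; apply: Pin.
- by move=> c; rewrite -(rtc c); apply: Pc.
- apply/fintype.subsetP => v; rewrite inE => /andP[_ /onto[c <-]]; exact: codom_f.
exists [:: lab a; lab b; lab c; lab d]; split => //.
  by move=> v; rewrite !inE => /or4P[]/eqP->.
move=> x; rewrite !big_cons big_nil finset.setU0 finset.setUA => /= xS.
have {H} := H x xS; move: xS; set S := _ :|: (_ :|: _) => xS H.
have := cardsID D A; have [xD|xD] := boolP (x \in D).
  have -> : A :&: component (adj G) S x = A :&: D :&: component (adj G) S x.
    rewrite -finset.setIA; congr (_ :&: _); apply/esym/finset.setIidPr.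
    apply: fintype.subset_trans (component_subset _ _ _) _.
    by apply/fintype.subsetP => v; rewrite component_whole !DE in xD *; apply: connect_trans.
  by move: H heavy; lia.
suff : A :&: component (adj G) S x \subset A :\: D.
  by move/subset_leq_card; move: heavy; lia.
apply/fintype.subsetP => v; rewrite !finset.in_setI finset.in_setD => /andP[-> xv]; rewrite andbT.
apply: contra xD; rewrite !DE => yv; apply: connect_trans yv _.
by rewrite cS -component_whole; apply: (fintype.subsetP (component_subset _ S _)).
Qed.

Local Open Scope ring_scope.

(** * Unique geodesics *)

Section WalkLength.
Context (R : realType) (V : finType) (w : {set V} -> R).

Lemma walk_length_nil x : walk_length w x [::] = 0.
Proof. by rewrite /walk_length big_nil. Qed.

Lemma walk_length_cons x y p :
  walk_length w x (y :: p) = w [set x; y]%SET + walk_length w y p.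
Proof. by rewrite /walk_length /= big_cons. Qed.

Lemma walk_length_cat x p q :
  walk_length w x (p ++ q) = walk_length w x p + walk_length w (last x p) q.
Proof. by rewrite /walk_length pairmap_cat big_cat. Qed.

Lemma walk_length_rev x p :
  walk_length w (last x p) (rev (belast x p)) = walk_length w x p.
Proof.
elim: p x => [|y p IH] x //=.
rewrite rev_cons -cats1 walk_length_cat IH walk_length_cons.
have -> : last (last y p) (rev (belast y p)) = y by case: p {IH} => //= z p; rewrite rev_cons last_rcons.
by rewrite walk_length_cons walk_length_nil addr0 addrC finset.setUC.
Qed.

End WalkLength.

Section Geodesics.
Context (R : realType) (V : finType) (G : graph V) (w : {set V} -> R).
Context (w_pos : positive_lengths G w).

Definition geodesic (x : V) (p : seq V) : Prop :=
  path (adj G) x p /\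
  forall q, path (adj G) x q -> last x q = last x p -> walk_length w x p <= walk_length w x q.

Lemma walk_length_ge0 x p : path (adj G) x p -> 0 <= walk_length w x p.
Proof.
elim: p x => [|y p IH] x /=; first by rewrite walk_length_nil.
by case/andP=> xy yp; rewrite walk_length_cons addr_ge0 ?IH // ltW ?w_pos.
Qed.

Lemma walk_length_gt0 x p : path (adj G) x p -> p != [::] -> 0 < walk_length w x p.
Proof.
case: p => //= y p /andP[xy yp] _.
by rewrite walk_length_cons ltr_pwDl ?walk_length_ge0 ?w_pos.
Qed.

Lemma shorten_walk x p : path (adj G) x p -> exists q,
  [/\ path (adj G) x q, uniq (x :: q), last x q = last x p & walk_length w x q <= walk_length w x p].
Proof.
elim: p x => [|y p IH] x /=; first by exists [::].
case/andP=> xy /IH[q [yq uq lq hq]].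
have h : walk_length w y q <= walk_length w x (y :: p).
  by rewrite walk_length_cons; apply: le_trans hq _; rewrite lerDr ltW ?w_pos.
have [xq|xq] := boolP (x \in y :: q); last first.
  exists (y :: q); split; rewrite /= ?xy // ?xq //.
  by rewrite !walk_length_cons lerD2l.
move: xq; rewrite inE => /predU1P[xy'|xq].
  by subst x; exists q.
case/splitPr: xq yq uq lq h => q1 q2.
rewrite cat_path last_cat /= => /and3P[yq1 lq1 xq2] uq lq h.
exists q2; split => //.
  by case/andP: uq => _; rewrite cat_uniq => /and3P[_ _].
apply: le_trans h; rewrite -cat_rcons walk_length_cat last_rcons lerDr.
by apply: walk_length_ge0; rewrite rcons_path yq1 lq1.
Qed.

(** Walks without repetition have bounded length, so they form a finite type and one of them is
    shortest; by loop erasure it also beats all other walks. *)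
Lemma geodesic_exists x y : connect (adj G) x y -> exists p,
  [/\ geodesic x p, uniq (x :: p) & last x p = y].
Proof.
case/connectP=> p0 /shorten_walk[q [xq uq lq _]] ly; rewrite -ly in lq.
have sz (s : seq V) : uniq s -> (size s <= #|V|)%N by move=> us; rewrite -(card_uniqP us) max_card.
pose Q (b : {bseq #|V| of V}) := [&& path (adj G) x b, uniq (x :: b) & last x b == y].
have ub s : uniq (x :: s) -> (size s <= #|V|)%N by move=> /andP[_ /sz].
pose b0 : {bseq #|V| of V} := Bseq (ub q uq).
have Qb0 : Q b0 by rewrite /Q /= xq lq eqxx andbT.
case: (arg_minP (fun b : {bseq #|V| of V} => walk_length w x b) Qb0) => b /and3P[xb ubn /eqP lb] minb.
exists b; split => //; split => // r xr lr.
have [r' [xr' ur' lr' hr']] := shorten_walk xr; apply: le_trans hr'.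
by apply: (minb (Bseq (ub r' ur'))); rewrite /Q /= xr' lr' lr lb eqxx andbT.
Qed.

Lemma geodesic_catl x p q : geodesic x (p ++ q) -> geodesic x p.
Proof.
case; rewrite cat_path => /andP[xp pq] H; split => // r xr lr.
have := H (r ++ q); rewrite cat_path xr lr pq !last_cat lr !walk_length_cat lr lerD2r.
exact.
Qed.

Lemma geodesic_catr x p q : geodesic x (p ++ q) -> geodesic (last x p) q.
Proof.
case; rewrite cat_path => /andP[xp pq] H; split => // r xr lr.
have := H (p ++ r); rewrite cat_path xp xr !last_cat lr !walk_length_cat lerD2l.
exact.
Qed.

Lemma last_rev_belast (x : V) p : last (last x p) (rev (belast x p)) = x.
Proof. by case: p => //= z p; rewrite rev_cons last_rcons. Qed.

Lemma path_adj_rev x p : path (adj G) x p -> path (adj G) (last x p) (rev (belast x p)).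
Proof.
by move=> xp; rewrite rev_path; apply: sub_path xp => u v; rewrite /= adj_sym.
Qed.

Lemma geodesic_rev x p : geodesic x p -> geodesic (last x p) (rev (belast x p)).
Proof.
case=> xp H; split; first exact: path_adj_rev.
move=> q lq; rewrite last_rev_belast => lastq; rewrite walk_length_rev.
rewrite -(walk_length_rev w (last x p)) lastq; apply: H.
  by have := path_adj_rev lq; rewrite lastq.
by rewrite -{1}lastq last_rev_belast.
Qed.

Lemma geodesic_uniq x p : geodesic x p -> uniq (x :: p).
Proof.
elim: p x => [|y p IH] x // gxp; have gyp : geodesic y p by apply: (@geodesic_catr x [:: y]).
rewrite cons_uniq IH // andbT; apply/negP => xp.
case/splitPr: xp gxp gyp => q1 q2; rewrite -cat_rcons => -[xp H] _.
have := H q2; move: xp; rewrite cat_path last_cat !last_rcons => /andP[xq1 ->] /(_ isT erefl).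
rewrite walk_length_cat last_rcons gerDr leNgt walk_length_gt0 //.
by case: (q1).
Qed.

End Geodesics.

Lemma binary_inj n (b c : 'I_n -> bool) :
  (\sum_(i < n) b i * 2 ^ i = \sum_(i < n) c i * 2 ^ i)%N -> b =1 c.
Proof.
elim: n b c => [|n IH] b c; first by move=> _ [].
rewrite !big_ord_recl /= !expn0 !muln1.
have E (d : 'I_n.+1 -> bool) : (\sum_(i < n) d (lift ord0 i) * 2 ^ (bump 0 i) =
    (\sum_(i < n) d (lift ord0 i) * 2 ^ i).*2)%N.
  rewrite -mul2n big_distrr; apply: eq_bigr => i _.
  by rewrite /bump add1n expnS mulnCA.
rewrite !E => h i; have h0 : b ord0 = c ord0.
  by have := congr1 odd h; rewrite !oddD !odd_double !addbF !oddb.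
have h1 := IH (fun i => b (lift ord0 i)) (fun i => c (lift ord0 i)).
have [j ->|->] := unliftP ord0 i; last by [].
by apply: h1; move: h; rewrite h0 => /addnI /double_inj.
Qed.

(** The elements receive the extra weights [d * 2 ^ i]. Binary expansions tell different sets of
    equal [l]-weight apart, and [d] is so small that the extra weights cannot reverse a strict
    inequality between sums of [l]. *)
Lemma generic_weight (R : realType) (E : finType) (l : E -> R) :
  exists w : E -> R, [/\ forall e, l e <= w e,
    forall A B : {set E}, \sum_(e in A) w e <= \sum_(e in B) w e ->
      \sum_(e in A) l e <= \sum_(e in B) l e &
    forall A B : {set E}, \sum_(e in A) w e = \sum_(e in B) w e -> A = B].
Proof.
pose code (A : {set E}) := (\sum_(i < #|E|) (enum_val i \in A) * 2 ^ i)%N.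
pose M := (\sum_(i < #|E|) 2 ^ i)%N.
have codeM A : (code A <= M)%N.
  by apply: leq_sum => i _; case: (_ \in A); rewrite ?mul1n ?mul0n.
have [d d0 dP] : exists2 d : R, 0 < d & forall q : {set E} * {set E},
    \sum_(e in q.1) l e < \sum_(e in q.2) l e ->
    d * M%:R < \sum_(e in q.2) l e - \sum_(e in q.1) l e.
  apply: fin_uniform => [q d d' d'0 dd' hq /hq|[A B]] /=.
    by apply: le_lt_trans; rewrite ler_wpM2r.
  have [AB|] := ltP (\sum_(e in A) l e) (\sum_(e in B) l e); last first.
    by exists 1.
  (* Dividing by [M.+1] rather than [M] makes the inequality strict. *)
  exists ((\sum_(e in B) l e - \sum_(e in A) l e) / M.+1%:R).
    by rewrite divr_gt0 ?subr_gt0 ?ltr0n.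
  move=> _; rewrite mulrAC ltr_pdivrMr ?ltr0n // ltr_pM2l ?subr_gt0 //.
  by rewrite ltr_nat.
pose w e := l e + d * (2 ^ enum_rank e)%:R.
have wE (A : {set E}) : \sum_(e in A) w e = \sum_(e in A) l e + d * (code A)%:R.
  rewrite big_split /= -big_distrr /=; congr (_ + d * _).
  rewrite /code -natr_sum; congr (_%:R).
  rewrite big_mkcond (reindex (fun i : 'I_#|E| => enum_val i)) /=; last first.
    by apply: onW_bij; exact: enum_val_bij.
  by apply: eq_bigr => i _; rewrite enum_valK; case: (_ \in A); rewrite ?mul1n ?mul0n.
have mono (A B : {set E}) : \sum_(e in A) w e <= \sum_(e in B) w e -> \sum_(e in A) l e <= \sum_(e in B) l e.
  rewrite !wE => h; rewrite leNgt; apply/negP => /(dP (B, A)) /= h'.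
  have : d * (code B)%:R <= d * M%:R by rewrite ler_pM2l // ler_nat.
  have : 0 <= d * (code A)%:R by rewrite mulr_ge0 // ltW.
  lra.
exists w; split => //.
  by move=> e; rewrite lerDl mulr_ge0 // ltW.
move=> A B AB; have hl : \sum_(e in A) l e = \sum_(e in B) l e.
  by apply/eqP; rewrite eq_le !mono ?AB.
move: AB; rewrite !wE hl => /addrI /mulfI; rewrite gt_eqF // => /(_ isT) /eqP.
rewrite eqr_nat => /eqP /binary_inj h; apply/setP => e.
by have := h (enum_rank e); rewrite enum_rankK.
Qed.

Definition walk_edges (V : finType) (x : V) (p : seq V) : {set {set V}} :=
  [set e in pairmap (fun u v => [set u; v]%SET) x p]%SET.

Lemma walk_edge_sub (V : finType) (x z : V) p e :
  e \in pairmap (fun u v => [set u; v]%SET) x p -> z \in e -> z \in x :: p.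
Proof.
elim: p x => //= y p IH x; rewrite inE => /predU1P[->|ep ze].
  by rewrite !inE => /orP[]->; rewrite ?orbT.
by rewrite inE (IH y) ?orbT.
Qed.

Lemma walk_edges_uniq (V : finType) (x : V) p :
  uniq (x :: p) -> uniq (pairmap (fun u v => [set u; v]%SET) x p).
Proof.
elim: p x => //= y p IH x /andP[xp up]; rewrite IH // andbT; apply/negP.
by move=> /walk_edge_sub /(_ (set21 _ _)); rewrite (negbTE xp).
Qed.

Lemma walk_length_edges (R : realType) (V : finType) (w : {set V} -> R) x p :
  uniq (x :: p) -> walk_length w x p = \sum_(e in walk_edges x p) w e.
Proof.
move=> /walk_edges_uniq up.
have -> : walk_length w x p = \sum_(e <- pairmap (fun u v => [set u; v]%SET) x p) w e.
  elim: p x {up} => [|y p IH] x /=; first by rewrite walk_length_nil big_nil.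
  by rewrite walk_length_cons IH big_cons.
by rewrite big_uniq //; apply: eq_bigl => e; rewrite inE.
Qed.

(** A walk without repetition uses only one edge at its start, which reveals the next vertex. *)
Lemma walk_edges_inj (V : finType) (x : V) p q :
  uniq (x :: p) -> uniq (x :: q) -> walk_edges x p = walk_edges x q -> p = q.
Proof.
elim: p x q => [|y p IH] x [|z q] //=.
- by move=> _ _ /setP/(_ [set x; z]%SET); rewrite !inE eqxx.
- by move=> _ _ /setP/(_ [set x; y]%SET); rewrite !inE eqxx.
move=> /andP[xp up] /andP[xq uq] /setP E.
have nx r u : x \notin u :: r -> forall v, [set x; v]%SET \notin pairmap (fun u v => [set u; v]%SET) u r.
  by move=> xr v; apply/negP => /walk_edge_sub /(_ (set21 _ _)); rewrite (negbTE xr).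
have yz : y = z.
  have := E [set x; y]%SET; rewrite !inE eqxx /= (negbTE (nx _ _ xq _)) orbF => /esym/eqP/set2_inj[[]//|[-> ->]].
  by [].
subst z; congr (_ :: _); apply: (IH y) => //; apply/setP => e.
have := E e; rewrite !inE; have [->|//] := eqVneq e [set x; y]%SET.
by rewrite (negbTE (nx _ _ xp _)) (negbTE (nx _ _ xq _)).
Qed.

(** The length of a walk without repetition is the weight of its edge set, so weights that separate
    sets of edges separate such walks. Competing walks are first loop-erased, as edge sets forget
    multiplicities. *)
Lemma generic_lengths (R : realType) (V : finType) (G : graph V) (l : {set V} -> R) :
  positive_lengths G l -> exists w : {set V} -> R,
  [/\ positive_lengths G w,
      forall x p, geodesic G w x p -> geodesic G l x p &
      forall x p q, geodesic G w x p -> geodesic G w x q -> last x p = last x q -> p = q].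
Proof.
move=> lpos; have [w [lw mono inj]] := generic_weight l.
have wpos : positive_lengths G w by move=> e eG; apply: lt_le_trans (lw e); apply: lpos.
exists w; split => // x p.
  move=> gp; have up := geodesic_uniq wpos gp; case: gp => xp H; split => // q0 xq0 lq0.
  have [q [xq uq lq hq]] := shorten_walk lpos xq0; apply: le_trans hq.
  rewrite !walk_length_edges //; apply: mono; rewrite -!walk_length_edges //.
  by apply: H => //; rewrite lq.
move=> q gp gq lpq.
have up := geodesic_uniq wpos gp; have uq := geodesic_uniq wpos gq.
apply: (walk_edges_inj up uq); apply: inj; rewrite -!walk_length_edges //.
by case: gp gq => xp Hp [xq Hq]; apply/eqP; rewrite eq_le Hp ?Hq.
Qed.

Local Close Scope ring_scope.

(** * Suppressing non-terminals *)

Lemma delete_vertex_exists (V : finType) (T : {set V}) (H : graph V) v :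
  v \in verts H -> v \notin T -> exists H',
  [/\ minor_op T H H', verts H' = verts H :\ v &
      forall x y, adj H' x y = [&& adj H x y, x != v & y != v]].
Proof.
move=> vH vT; have wf e : e \in [set e in edges H | v \notin e]%SET -> #|e| = 2 /\ e \subset verts H :\ v.
  rewrite inE => /andP[/edges_wf[-> sH] ve]; split => //.
  by rewrite subsetD1 sH.
exists (Graph wf); split => //; first exact: DeleteVertex vH vT _ _.
by move=> x y; rewrite /adj !inE negb_or ![v == _]eq_sym.
Qed.

Lemma delete_edge_exists (V : finType) (T : {set V}) (H : graph V) e :
  e \in edges H -> exists H',
  [/\ minor_op T H H', verts H' = verts H & edges H' = edges H :\ e].
Proof.
move=> eH; have wf f : f \in edges H :\ e -> #|f| = 2 /\ f \subset verts H.
  by rewrite inE => /andP[_ /edges_wf].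
by exists (Graph wf); split => //; exact: DeleteEdge eH _ _.
Qed.

Lemma contract_exists (V : finType) (T : {set V}) (H : graph V) a v :
  adj H a v -> v \notin T -> exists H',
  [/\ minor_op T H H', verts H' = verts H :\ v &
      forall x y, adj H' x y = [&& x != v, y != v, x != y &
        [|| adj H x y, (x == a) && adj H v y | (y == a) && adj H x v]]].
Proof.
move=> av vT; have [aH vH nav] := adj_verts av.
pose f x := if x == v then a else x.
have im p q : [set f x | x in [set p; q]]%SET = [set f p; f q]%SET by rewrite imsetU1 imset_set1.
pose E := [set [set (if x == v then a else x) | x : V in e]%SET
                   | e : {set V} in edges H :\ [set a; v]%SET]%SET.
have wf e : e \in E -> #|e| = 2 /\ e \subset verts H :\ v.
  case/imsetP=> e0; rewrite !inE => /andP[ne e0H] ->.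
  have [/eqP/cards2P[p [q [npq e0E]]] sH] := edges_wf e0H; subst e0.
  have [pH qH _] := adj_verts e0H.
  have -> : [set (if x == v then a else x) | x in [set p; q]]%SET = [set f p; f q]%SET by exact: im.
  split.
    rewrite cards2; suff -> : f p != f q by [].
    rewrite /f; move: ne npq.
    case: (eqVneq p v) => [->|_]; case: (eqVneq q v) => [->|_]; rewrite ?eqxx //.
      by move=> ne _; apply: contraNneq ne => <-; rewrite finset.setUC.
    by move=> ne _; apply: contraNneq ne => ->.
  have fD z : z \in verts H -> f z \in verts H :\ v.
    by rewrite !inE /f; case: (eqVneq z v) => [_ _|->] //; rewrite nav aH.
  by apply/fintype.subsetP => x /set2P[]->; apply: fD.
exists (Graph wf); split => //; first exact: ContractEdge av vT _ _.
move=> x y; rewrite {1}/adj /=; apply/imsetP/and4P.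
  case=> e0; rewrite !inE => /andP[ne e0H].
  have [/eqP/cards2P[p [q [npq e0E]]] sH] := edges_wf e0H; subst e0.
  rewrite -/f im => /set2_inj.
  have aux r s : [set r; s]%SET \in edges H -> [set r; s]%SET != [set a; v]%SET -> r != s ->
     [/\ f r != v, f s != v, f r != f s & 
      [|| adj H (f r) (f s), (f r == a) && adj H v (f s) | (f s == a) && adj H (f r) v]].
    move=> rsH ne' nrs.
    have fv z : f z != v by rewrite /f; case: (eqVneq z v).
    split => //; rewrite /f; move: rsH ne' nrs.
      case: (eqVneq r v) => [->|_]; case: (eqVneq s v) => [->|_]; rewrite ?eqxx //.
        by move=> _ ne' _; apply: contraNneq ne' => <-; rewrite finset.setUC.
      by move=> _ ne' _; apply: contraNneq ne' => ->.
    by case: (eqVneq r v) => [->|_]; case: (eqVneq s v) => [->|_]; rewrite ?eqxx //= /adj => ->; rewrite ?orbT.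
  case=> [[-> ->]|[-> ->]]; first exact: aux.
  have := aux q p; rewrite finset.setUC => /(_ e0H); apply.
    exact: ne.
  by rewrite eq_sym.
case=> xv yv xy h.
have fx : f x = x by rewrite /f (negbTE xv).
have fy : f y = y by rewrite /f (negbTE yv).
have fvE : f v = a by rewrite /f eqxx.
case/or3P: h => [h|/andP[/eqP xa h]|/andP[/eqP ya h]].
- exists [set x; y]%SET; last by rewrite -/f im fx fy.
  rewrite !inE; apply/andP; split; last exact: h.
  apply/eqP => /setP/(_ v).
  by rewrite !inE eqxx orbT ![v == _]eq_sym (negbTE xv) (negbTE yv).
- exists [set v; y]%SET; last by rewrite -/f im fvE fy xa.
  rewrite !inE; apply/andP; split; last exact: h.
  apply/eqP => /setP/(_ y).
  by rewrite !inE eqxx orbT (negbTE yv) -xa eq_sym (negbTE xy).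
- exists [set x; v]%SET; last by rewrite -/f im fvE fx ya.
  rewrite !inE; apply/andP; split; last exact: h.
  apply/eqP => /setP/(_ x).
  by rewrite !inE eqxx (negbTE xv) -ya (negbTE xy).
Qed.

Lemma filter_predC1_id (V : eqType) (v : V) (s : seq V) : v \notin s -> [seq x <- s | x != v] = s.
Proof. by move=> vs; apply/all_filterP/allP => x xs /=; apply: contraNneq vs => <-. Qed.

(** A vertex outside [K] is deleted if no sequence of [F] uses it. Otherwise it has exactly two
    neighbours, every sequence through it passes from one to the other, and contracting it into one
    of them shortcuts all these sequences at once. *)
Lemma suppress_nonterminals (V : finType) (T K : {set V}) (G H : graph V) (F : seq (seq V)) :
  T \subset K -> K \subset verts H -> minor T G H ->
  (forall x p, x :: p \in F -> [/\ path (adj H) x p, uniq (x :: p), x \in K & last x p \in K]) ->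
  (forall v, v \in verts H -> v \notin K -> #|[set u | adj H v u]%SET| <= 2) ->
  exists H', [/\ minor T G H', verts H' = K,
    forall s, s \in F -> sorted (adj H') ([seq x <- s | x \in K]) &
    forall x y, adj H' x y -> connect (adj H) x y].
Proof.
move=> TK; have [n] := ubnP #|verts H :\: K|.
elim: n H F => // n IH H F sz KH mH HF deg.
have [vK|[v]] := set_0Vmem (verts H :\: K).
  have eK : verts H = K.
    by apply/eqP; rewrite finset.eqEsubset KH -finset.setD_eq0 vK eqxx.
  exists H; split => //; last by move=> x y xy; apply: connect1.
  move=> [|x p] // /HF[xp _ xK _].
  suff /all_filterP-> : all (mem K) (x :: p) by [].
  elim: p x xp xK => [|y p IHp] x /=; first by move=> _ ->.
  case/andP=> /adj_verts[_ yH _] yp xK; rewrite xK /=.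
  by apply: IHp => //; rewrite -eK.
rewrite inE => /andP[vK vH].
have vT : v \notin T by apply: contra vK; apply: (fintype.subsetP TK).
have szD (H1 : graph V) : verts H1 = verts H :\ v -> #|verts H1 :\: K| < n.
  move=> ->; apply: leq_trans (sz : _ <= n); apply: proper_card; apply/properP; split.
    by apply/fintype.subsetP => x; rewrite !inE => /andP[-> /andP[_ ->]].
  by exists v; rewrite !inE ?vK ?vH // eqxx andbF.
have KD : K \subset verts H :\ v by rewrite subsetD1 KH.
have fK s : [seq x <- [seq x <- s | x != v] | x \in K] = [seq x <- s | x \in K].
  rewrite -filter_predI; apply: eq_filter => x /=.
  by case: eqVneq => [->|] /=; rewrite ?andbT ?andbF // (negbTE vK).
pose F' := [seq [seq x <- s | x != v] | s <- F].
have nK x : x \in K -> x != v by move=> xK; apply: contraNneq vK => <-.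
have F'P (H1 : graph V) : (forall s, s \in F -> sorted (adj H1) ([seq x <- s | x != v])) ->
    forall x p, x :: p \in F' -> [/\ path (adj H1) x p, uniq (x :: p), x \in K & last x p \in K].
  move=> hs x p /mapP[[|y q] // sF]; have [yq uq yK lK] := HF _ _ sF.
  have := hs _ sF; rewrite /= nK //= => h1 [-> ->]; split => //.
    by rewrite /= mem_filter (negbTE (proj1 (andP uq))) andbF filter_uniq //; case/andP: uq.
  case/lastP: q {sF yq uq h1} lK => [|q z] //; rewrite last_rcons => zK.
  by rewrite filter_rcons /= nK // last_rcons.
have done_ H1 : verts H1 = verts H :\ v -> minor T G H1 ->
   (forall s, s \in F -> sorted (adj H1) ([seq x <- s | x != v])) ->
   (forall w, w \in verts H1 -> w \notin K -> #|[set u | adj H1 w u]%SET| <= 2) ->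
   (forall x y, adj H1 x y -> connect (adj H) x y) ->
   exists H', [/\ minor T G H', verts H' = K,
    forall s, s \in F -> sorted (adj H') ([seq x <- s | x \in K]) &
    forall x y, adj H' x y -> connect (adj H) x y].
  move=> vH1 mH1 sF degH1 cH1.
  have [|H' [mH' vH' sH' cH']] := IH H1 F' (szD _ vH1) _ mH1 (F'P _ sF) degH1.
    by rewrite vH1.
  exists H'; split => //.
    by move=> s sF0; rewrite -fK; apply: sH'; apply: map_f.
  move=> x y /cH'; apply: connect_sub => a b; exact: cH1.
have [hv|nv] := boolP (has (fun s => v \in s) F); last first.
  have [H1 [op1 vH1 aH1]] := delete_vertex_exists vH vT.
  apply: (done_ H1 vH1 (MinorStep mH op1)).
  - move=> s sF; have vs : v \notin s by apply: contra nv => vs; apply/hasP; exists s.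
    rewrite filter_predC1_id //; case: s sF vs => // x p /HF[xp _ _ _].
    elim: p x xp => //= y p IHp x /andP[xy yp]; rewrite !inE !negb_or => /and3P[vx vy vp].
    by rewrite aH1 xy eq_sym vx eq_sym vy /=; apply: IHp => //; rewrite inE negb_or vy.
  - move=> w; rewrite vH1 inE => /andP[_ wH] wK; apply: leq_trans (deg w wH wK).
    by apply: subset_leq_card; apply/fintype.subsetP => u; rewrite !inE aH1 => /and3P[].
  - by move=> x y; rewrite aH1 => /and3P[xy _ _]; apply: connect1.
(* The ends of a sequence lie in [K], so [v] is an inner vertex and has a neighbour on each side. *)
have vnbr s1 s2 : s1 ++ v :: s2 \in F -> exists a b t1 t2,
    [/\ s1 = rcons t1 a, s2 = b :: t2, adj H v a, adj H v b & a != b].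
  case: s1 => [|x p] /HF[xp ux xK lK].
    by move: vK; rewrite xK.
  case: s2 xp ux lK => [|b t2] xp ux lK.
    by move: vK lK; rewrite last_cat => /negbTE /= ->.
  exists (last x p), b, (belast x p), t2; rewrite -lastI; split => //.
  - by move: xp; rewrite cat_path /= adj_sym => /and3P[].
  - by move: xp; rewrite cat_path /= => /and4P[].
  - apply/eqP => e; move: ux; rewrite -cat_cons cat_uniq => /and3P[_ /hasP[]].
    exists b; first by rewrite !inE eqxx orbT.
    by rewrite -e; apply: mem_last.
have [s sF vs] := hasP hv.
case/splitPr: vs sF => s1 s2 /vnbr[a [b [_ [_ [_ _ va vb nab]]]]].
have Nv u : adj H v u = (u == a) || (u == b).
  have eN : [set a; b]%SET = [set u | adj H v u]%SET.
    apply/eqP; rewrite eqEcard cards2 nab deg // andbT.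
    by apply/fintype.subsetP => z /set2P[]->; rewrite inE.
  by have /setP/(_ u) := eN; rewrite !inE.
have av : adj H a v by rewrite adj_sym.
have [_ _ nav] := adj_verts av; have [_ _ nvb] := adj_verts vb.
have [H1 [op1 vH1 aH1]] := contract_exists av vT.
have adj1 x y : x != v -> y != v -> adj H x y -> adj H1 x y.
  by move=> xv yv xy; rewrite aH1 xv yv xy; have [_ _ ->] := adj_verts xy.
have ab1 : adj H1 a b by rewrite aH1 nav eq_sym nvb nab eqxx vb orbT.
apply: (done_ H1 vH1 (MinorStep mH op1)).
- move=> s' s'F.
  have sub p x : path (adj H) x p -> v \notin x :: p -> path (adj H1) x p.
    elim: p x => //= y p IHp x /andP[xy yp]; rewrite !inE !negb_or => /and3P[vx vy vp].
    by rewrite adj1 // 1?eq_sym //=; apply: IHp => //; rewrite inE negb_or vy.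
  have [vs|vs] := boolP (v \in s'); last first.
    rewrite filter_predC1_id //; case: s' s'F vs => // x p /HF[xp _ _ _]; exact: sub.
  case/splitPr: vs s'F => r1 r2 rF; have [c [d [t1 [t2 [e1 e2 vc vd ncd]]]]] := vnbr _ _ rF.
  subst r1 r2; move: rF; rewrite headI; set x := head c t1; set p := behead _ => rF.
  have lp : last x p = c by have := last_rcons x t1 c; rewrite headI.
  have [xp ux _ _] := HF _ _ rF.
  have := ux; rewrite -cat_cons cat_uniq => /and3P[_ nh]; rewrite cons_uniq => /andP[vd2 _].
  have vxp : v \notin x :: p.
    by apply: contra nh => vxp; apply/hasP; exists v; rewrite ?mem_head.
  have -> : [seq y <- (x :: p) ++ v :: d :: t2 | y != v] = (x :: p) ++ d :: t2.
    rewrite filter_cat (filter_predC1_id vxp); congr (_ ++ _).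
    by rewrite -[RHS](filter_predC1_id vd2) /= eqxx.
  move: xp; rewrite !cat_path /= lp => /and4P[xp _ _ dt2].
  rewrite /= cat_path /= lp !sub //= andbT.
  move: vc vd ncd; rewrite !Nv => /orP[]/eqP-> /orP[]/eqP->; rewrite ?eqxx //.
  by rewrite adj_sym.
- move=> w; rewrite vH1 inE => /andP[wv wH] wK; apply: leq_trans (deg w wH wK).
  (* At [a] and [b] the lost neighbour [v] makes room for the one gained, so degrees do not grow. *)
  have swap o : adj H w v -> (forall u, adj H1 w u -> u \in o |: [set u | adj H w u]%SET :\ v) ->
      #|[set u | adj H1 w u]%SET| <= #|[set u | adj H w u]%SET|.
    move=> wv' sub; rewrite [X in _ <= X](cardsD1 v) inE wv'.
    apply: (@leq_trans #|o |: [set u | adj H w u]%SET :\ v|).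
      by apply: subset_leq_card; apply/fintype.subsetP => u; rewrite inE; apply: sub.
    by rewrite cardsU1 leq_add2r leq_b1.
  have [wa|nwa] := eqVneq w a; last have [wb|nwb] := eqVneq w b.
  - apply: (swap b); first by rewrite wa.
    move=> u; rewrite aH1 !inE Nv => /and4P[_ uv wu].
    rewrite uv wa eqxx /= -wa [u == w]eq_sym (negbTE wu) /= orbF.
    by case/orP=> ->; rewrite ?orbT.
  - apply: (swap a); first by rewrite wb adj_sym.
    move=> u; rewrite aH1 !inE => /and4P[_ uv wu].
    rewrite uv (negbTE nwa) /=; case/orP=> [->|/andP[-> _]]; by rewrite ?orbT.
  - apply: subset_leq_card; apply/fintype.subsetP => u; rewrite !inE aH1.
    rewrite [adj H w v]adj_sym (Nv w) (negbTE nwa) (negbTE nwb) /= andbF orbF.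
    by case/and4P.
- move=> x y; rewrite aH1 => /and4P[_ _ _ /or3P[xy|/andP[/eqP-> vy]|/andP[/eqP-> xv]]].
  + exact: connect1.
  + by apply: connect_trans (connect1 vy); apply: connect1.
  + by apply: connect_trans (connect1 xv) _; apply: connect1.
Qed.

Lemma uniq_split (V : eqType) (v : V) (s1 s2 t1 t2 : seq V) :
  uniq (s1 ++ v :: s2) -> s1 ++ v :: s2 = t1 ++ v :: t2 -> s1 = t1 /\ s2 = t2.
Proof.
elim: s1 t1 => [|x s1 IH] [|y t1] /=.
- by move=> _ [].
- by move=> /andP[+ _] [<- e]; rewrite e mem_cat mem_head orbT.
- by move=> /andP[+ _] [xv e]; rewrite xv mem_cat inE eqxx orbT.
- by move=> /andP[_ us] [-> /IH] /(_ us)[-> ->].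
Qed.

(** * Branch vertices of a family of geodesics *)

Section GeodesicFamilies.
Context (R : realType) (V : finType) (G : graph V) (w : {set V} -> R).
Context (w_pos : positive_lengths G w).
Context (w_gen : forall x p q, geodesic G w x p -> geodesic G w x q -> last x p = last x q -> p = q).

Definition geodesic_seq (s : seq V) : Prop := if s is x :: p then geodesic G w x p else True.

Lemma geodesic_seq_catl s t : geodesic_seq (s ++ t) -> geodesic_seq s.
Proof. by case: s => //= x p; apply: geodesic_catl. Qed.

Lemma geodesic_seq_catr s t : geodesic_seq (s ++ t) -> geodesic_seq t.
Proof.
case: s => //= x p; case: t => [|y q] //=; rewrite -cat_rcons => /geodesic_catr.
by rewrite last_rcons.
Qed.

Lemma geodesic_seq_uniq s : geodesic_seq s -> uniq s.
Proof. by case: s => // x p; apply: geodesic_uniq. Qed.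

(** The parts between [u] and [u'] are geodesics with the same ends, one possibly reversed, so
    uniqueness identifies them. *)
Lemma geodesic_seq_common s1 u m u' s2 t :
  geodesic_seq (s1 ++ u :: m ++ u' :: s2) -> geodesic_seq t -> u \in t -> u' \in t ->
  exists t1 t2, t = t1 ++ u :: m ++ u' :: t2 \/ t = t1 ++ u' :: rev m ++ u :: t2.
Proof.
move=> /[dup] /geodesic_seq_uniq us /geodesic_seq_catr; rewrite -cat_rcons -cat_cons => /geodesic_seq_catl gm.
have nuu' : u != u'.
  move: us; rewrite cat_uniq => /and3P[_ _]; rewrite /= mem_cat inE !negb_or.
  by case/andP=> /and3P[].
move=> gt ut; case/splitPr: ut gt => t1 t2 gt; rewrite mem_cat inE [u' == u]eq_sym (negbTE nuu') /=.
case/orP=> u't; case/splitPr: u't gt => r1 r2.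
  rewrite -catA cat_cons => /geodesic_seq_catr; rewrite -cat_rcons -cat_cons => /geodesic_seq_catl gr.
  exists r1, t2; right.
  have /= := geodesic_rev gm; rewrite last_rcons belast_rcons rev_cons => gm'.
  have := w_gen gr gm'; rewrite !last_rcons => /(_ erefl) /rcons_inj[->].
  by rewrite cat_rcons.
move=> /geodesic_seq_catr; rewrite -cat_rcons -cat_cons => /geodesic_seq_catl gr.
exists t1, r2; left.
have := w_gen gr gm; rewrite !last_rcons => /(_ erefl) /rcons_inj[->].
by rewrite cat_cons cat_rcons.
Qed.

(* Geodesics meet along a common segment, so a vertex where two of them part is
   the first or the last vertex of one of them on the other. *)
Definition branch_seq (F : seq (seq V)) : seq V :=
  pmap id ([seq ohead [seq x <- P | x \in Q] | P <- F, Q <- F] ++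
           [seq ohead (rev [seq x <- P | x \in Q]) | P <- F, Q <- F]).

Lemma size_branch_seq F : size (branch_seq F) <= 2 * size F ^ 2.
Proof.
rewrite size_pmap; apply: leq_trans (count_size _ _) _.
by rewrite size_cat !size_allpairs mul2n addnn.
Qed.

Lemma branch_seq_head F P Q : P \in F -> Q \in F -> forall x s,
  [seq x <- P | x \in Q] = x :: s -> x \in branch_seq F.
Proof.
move=> PF QF x s e; rewrite mem_pmap map_id mem_cat; apply/orP; left.
by apply/allpairsP; exists (P, Q); rewrite e.
Qed.

Lemma branch_seq_last F P Q : P \in F -> Q \in F -> forall x s,
  [seq x <- P | x \in Q] = rcons s x -> x \in branch_seq F.
Proof.
move=> PF QF x s e; rewrite mem_pmap map_id mem_cat; apply/orP; right.
by apply/allpairsP; exists (P, Q); rewrite e rev_rcons.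
Qed.

(** The pair of a sequence with itself contributes its two ends. *)
Lemma branch_seq_ends F x p : x :: p \in F -> x \in branch_seq F /\ last x p \in branch_seq F.
Proof.
move=> sF; have e : [seq y <- x :: p | y \in x :: p] = x :: p by apply/all_filterP/allP.
split; first exact: (branch_seq_head sF sF e).
by apply: (branch_seq_last sF sF (s := belast x p)); rewrite e lastI.
Qed.

Lemma branch_seq_inner F s1 v s2 Q : s1 ++ v :: s2 \in F -> Q \in F -> v \in Q ->
  v \notin branch_seq F -> (exists2 z, z \in s1 & z \in Q) /\ (exists2 z, z \in s2 & z \in Q).
Proof.
move=> PF QF vQ vb; have hh := branch_seq_head PF QF; have hl := branch_seq_last PF QF.
rewrite filter_cat /= vQ in hh hl; split.
  case E : [seq x <- s1 | x \in Q] => [|z s].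
    by have := hh v; rewrite E => /(_ _ erefl); rewrite (negbTE vb).
  have : z \in [seq x <- s1 | x \in Q] by rewrite E mem_head.
  by rewrite mem_filter => /andP[zQ zs]; exists z.
case/lastP E : [seq x <- s2 | x \in Q] => [|s z].
  by have := hl v; rewrite E cats1 => /(_ _ erefl); rewrite (negbTE vb).
have : z \in [seq x <- s2 | x \in Q] by rewrite E mem_rcons mem_head.
by rewrite mem_filter => /andP[zQ zs]; exists z.
Qed.

(** On the first geodesic there are vertices of the second on both sides of [v], so [v] is interior
    to a common segment. For the same reason all four lists are nonempty and the default [v] of
    [last] and [head] is never taken. *)
Lemma geodesic_neighbours F s1 v s2 t1 t2 :
  (forall s, s \in F -> geodesic_seq s) ->
  s1 ++ v :: s2 \in F -> t1 ++ v :: t2 \in F -> v \notin branch_seq F ->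
  (last v t1 = last v s1 /\ head v t2 = head v s2) \/
  (last v t1 = head v s2 /\ head v t2 = last v s1).
Proof.
move=> gF sF tF vb.
have vQ : v \in t1 ++ v :: t2 by rewrite mem_cat mem_head orbT.
have [[z zs1 zQ] [z' z's2 z'Q]] := branch_seq_inner sF tF vQ vb.
have ut := geodesic_seq_uniq (gF _ tF).
case/splitPr: zs1 sF => a1 a2; case/splitPr: z's2 => b1 b2 sF.
have := @geodesic_seq_common a1 z (a2 ++ v :: b1) z' b2 _ _ (gF _ tF) zQ z'Q.
have -> : a1 ++ z :: (a2 ++ v :: b1) ++ z' :: b2 = (a1 ++ z :: a2) ++ v :: b1 ++ z' :: b2.
  by rewrite -!catA.
move=> /(_ (gF _ sF))[c1 [c2 [e|e]]].
  have [-> ->] : t1 = c1 ++ z :: a2 /\ t2 = b1 ++ z' :: c2.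
    by apply: (uniq_split ut); rewrite e -!catA.
  by left; rewrite !last_cat; case: (b1).
have [-> ->] : t1 = c1 ++ z' :: rev b1 /\ t2 = rev a2 ++ z :: c2.
  by apply: (uniq_split ut); rewrite e rev_cat rev_cons -cats1 -!catA.
right; rewrite !last_cat /=.
split; first by case: (b1) => //= y b; rewrite rev_cons last_rcons.
by case/lastP: (a2) => [|a y] //; rewrite rev_rcons last_rcons.
Qed.

End GeodesicFamilies.

Lemma delete_edges (V : finType) (T : {set V}) (G : graph V) (P : pred {set V}) :
  exists H, [/\ minor T G H, verts H = verts G & edges H = [set e in edges G | P e]%SET].
Proof.
suff {P} H n (P : pred {set V}) H : #|[set e in edges H | ~~ P e]%SET| <= n -> minor T G H ->
    exists H', [/\ minor T G H', verts H' = verts H & edges H' = [set e in edges H | P e]%SET].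
  by apply: (H _ P G (leqnn _)); exact: MinorRefl.
elim: n H => [|n IH] H sz mH.
  exists H; split => //; apply/setP => e; rewrite inE.
  have [eH|//] := boolP (e \in edges H); move: sz; rewrite leqn0 cards_eq0 => /eqP/setP/(_ e).
  by rewrite !inE eH /= => /negbFE.
have [E0|[e]] := set_0Vmem [set e in edges H | ~~ P e]%SET.
  by apply: (IH H) => //; rewrite E0 cards0.
rewrite inE => /andP[eH nPe].
have [H1 [op1 vH1 eH1]] := delete_edge_exists T eH.
have [|H' [mH' vH' eH']] := IH H1 _ (MinorStep mH op1).
  rewrite -ltnS; apply: leq_trans sz; apply: proper_card; apply/properP; split.
    by apply/fintype.subsetP => f; rewrite !inE eH1 !inE => /andP[/andP[_ ->] ->].
  by exists e; rewrite !inE ?eH ?eH1 ?inE ?eqxx.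
exists H'; split => //; first by rewrite vH'.
rewrite eH' eH1; apply/setP => f; rewrite !inE.
by have [->|//] := eqVneq f e; rewrite (negbTE nPe) !andbF.
Qed.

Lemma pairmap_neighbour (V : finType) (v u x : V) p : v != u ->
  [set v; u]%SET \in pairmap (fun a b => [set a; b]%SET) x p ->
  exists t1 t2, x :: p = t1 ++ v :: t2 /\ (u = head v t2 \/ u = last v t1).
Proof.
move=> nvu; elim: p x => //= y p IH x; rewrite inE => /predU1P[/set2_inj[[-> ->]|[-> ->]]|].
- by exists [::], (y :: p); split; [|left].
- by exists [:: x], p; split; [|right].
- move=> /IH[t1 [t2 [-> h]]]; exists (x :: t1), t2; split => //.
  case: h => [|ul]; [by left|right].
  by case: t1 ul => //= uv; rewrite uv eqxx in nvu.
Qed.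

(** Once all edges off the family are deleted, a vertex that is not a branch vertex has at most the
    two neighbours it has on any one sequence through it, so it can be suppressed. *)
Lemma geodesic_family_minor (R : realType) (V : finType) (G : graph V) (w : {set V} -> R)
    (T : {set V}) (F : seq (seq V)) :
  positive_lengths G w ->
  (forall x p q, geodesic G w x p -> geodesic G w x q -> last x p = last x q -> p = q) ->
  (forall s, s \in F -> geodesic_seq G w s /\ {subset s <= verts G}) ->
  T \subset verts G ->
  let K := (T :|: [set x in branch_seq F])%SET in
  exists H, [/\ minor T G H, verts H = K,
    forall s, s \in F -> sorted (adj H) [seq x <- s | x \in K] &
    forall x y, adj H x y -> connect (adj G) x y].
Proof.
move=> w_pos w_gen FP TG K.
pose edge_seq (s : seq V) := if s is x :: p then pairmap (fun a b => [set a; b]%SET) x p else [::].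
have [H0 [mH0 vH0 eH0]] := delete_edges T G (fun e => has (fun s => e \in edge_seq s) F).
have adj0 x y : adj H0 x y = adj G x y && has (fun s => [set x; y]%SET \in edge_seq s) F.
  by rewrite /adj eH0 inE.
have KG : K \subset verts G.
  rewrite finset.subUset TG /=; apply/fintype.subsetP => x; rewrite inE.
  rewrite mem_pmap map_id mem_cat => /orP[]/allpairsP[[P Q] [/= /FP[_ PG] _ e]].
    case E : [seq x <- P | x \in Q] e => [|y s] //= [->]; apply: PG.
    have yin : y \in [seq x <- P | x \in Q] by rewrite E mem_head.
    by move: yin; rewrite mem_filter => /andP[].
  case/lastP E : [seq x <- P | x \in Q] e => [|s y] //.
  rewrite rev_rcons => -[->]; apply: PG.
  have yin : y \in [seq x <- P | x \in Q] by rewrite E mem_rcons mem_head.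
  by move: yin; rewrite mem_filter => /andP[].
have [|||||H [mH vH sH cH]] := @suppress_nonterminals V T K G H0 F.
- exact: finset.subsetUl.
- by rewrite vH0.
- by [].
- move=> x p xpF; have [gx _] := FP _ xpF; have [b1 b2] := branch_seq_ends xpF.
  split; last 2 first.
  + by rewrite !inE b1 orbT.
  + by rewrite !inE b2 orbT.
  + have sub q y : path (adj G) y q -> {subset pairmap (fun a b => [set a; b]%SET) y q <= edge_seq (x :: p)} ->
        path (adj H0) y q.
      elim: q y => //= z q IH y /andP[yz zq] sb; rewrite adj0 yz IH //=; last first.
        by move=> e eq_; apply: sb; rewrite inE eq_ orbT.
      by rewrite andbT; apply/hasP; exists (x :: p) => //; apply: sb; rewrite mem_head.
    by apply: sub => //; case: gx.
  + exact: (geodesic_seq_uniq w_pos gx).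
- move=> v vG vK; have [->|[u]] := set_0Vmem [set u | adj H0 v u]%SET; first by rewrite cards0.
  have vb : v \notin branch_seq F by move: vK; rewrite !inE negb_or => /andP[].
  have nbr z : adj H0 v z -> exists t1 t2, t1 ++ v :: t2 \in F /\ (z = head v t2 \/ z = last v t1).
    rewrite adj0 => /andP[/adj_verts[_ _ nvz] /hasP[[|x p] // sF /(pairmap_neighbour nvz)]].
    by case=> t1 [t2 [e h]]; exists t1, t2; rewrite -e.
  rewrite inE => /nbr[s1 [s2 [sF _]]].
  apply: (@leq_trans #|[set last v s1; head v s2]%SET|); last by rewrite cards2; case: eqP.
  apply: subset_leq_card; apply/fintype.subsetP => z; rewrite !inE => /nbr[t1 [t2 [tF h]]].
  have gF s : s \in F -> geodesic_seq G w s by move=> /FP[].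
  case: (geodesic_neighbours w_pos w_gen gF sF tF vb) h => [[-> ->]|[-> ->]] [->|->]; by rewrite eqxx ?orbT.
exists H; split => // x y /cH; apply: connect_sub => a b; rewrite adj0 => /andP[ab _].
exact: connect1.
Qed.

Local Open Scope ring_scope.

(** * Distances in the minor *)

Section Distance.
Context (R : realType) (V : finType) (G : graph V) (l : {set V} -> R).

Lemma dist_le_walk x p : path (adj G) x p ->
  (dist G l x (last x p) <= (walk_length l x p)%:E)%E.
Proof. by move=> xp; apply: ereal_inf_lbound; exists p. Qed.

Lemma le_dist x y (d : \bar R) :
  (forall p, path (adj G) x p -> last x p = y -> (d <= (walk_length l x p)%:E)%E) ->
  (d <= dist G l x y)%E.
Proof. by move=> H; apply/ereal_infP => _ [p [xp lp ->]]; apply: H. Qed.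

Lemma dist_geodesic x p : geodesic G l x p -> dist G l x (last x p) = (walk_length l x p)%:E.
Proof.
case=> xp H; apply/eqP; rewrite eq_le dist_le_walk //=.
by apply: le_dist => q xq lq; rewrite lee_fin H.
Qed.

Lemma dist_sym x y : dist G l x y = dist G l y x.
Proof.
suff H u v : (dist G l u v <= dist G l v u)%E by apply/eqP; rewrite eq_le !H.
apply: le_dist => p vp <-; have := dist_le_walk (path_adj_rev vp).
by rewrite last_rev_belast walk_length_rev.
Qed.

Lemma dist_disconnected x y : ~~ connect (adj G) x y -> dist G l x y = +oo%E.
Proof.
move=> nxy; apply/eqP; rewrite -leye_eq; apply: le_dist => p xp lp.
by case/negP: nxy; apply/connectP; exists p.
Qed.

(** [fine] sends [+oo] to 0, so this is the distance only between connected vertices. *)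
Definition gdist x y : R := fine (dist G l x y).

Context (l_pos : positive_lengths G l).

Lemma dist_connected x y : connect (adj G) x y -> dist G l x y = (gdist x y)%:E.
Proof.
by case/(geodesic_exists l_pos)=> p [gp _ <-]; rewrite /gdist dist_geodesic.
Qed.

Lemma gdist_geodesic x p : geodesic G l x p -> gdist x (last x p) = walk_length l x p.
Proof. by move=> gp; rewrite /gdist dist_geodesic. Qed.

Lemma gdist_sym x y : gdist x y = gdist y x.
Proof. by rewrite /gdist dist_sym. Qed.

Lemma gdist_le_walk x p : path (adj G) x p -> gdist x (last x p) <= walk_length l x p.
Proof.
move=> xp; rewrite -lee_fin -dist_connected ?dist_le_walk //.
by apply/connectP; exists p.
Qed.

Lemma gdist_refl x : gdist x x = 0.
Proof.
have g0 : geodesic G l x [::] by split => // q xq _; rewrite walk_length_nil (walk_length_ge0 l_pos xq).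
by have := gdist_geodesic g0; rewrite walk_length_nil.
Qed.

Lemma gdist_triangle x y z : connect (adj G) x y -> connect (adj G) y z ->
  gdist x z <= gdist x y + gdist y z.
Proof.
case/(geodesic_exists l_pos)=> p [gp _ <-] /(geodesic_exists l_pos)[q [gq _ <-]].
rewrite !gdist_geodesic // -walk_length_cat -last_cat; apply: gdist_le_walk.
by rewrite cat_path; case: gp gq => -> _ [-> _].
Qed.

Lemma gdist_gt0 x y : connect (adj G) x y -> x != y -> 0 < gdist x y.
Proof.
case/(geodesic_exists l_pos)=> p [gp _ <-] nxy; rewrite gdist_geodesic //.
apply: (walk_length_gt0 l_pos); first by case: gp.
by apply: contraNneq nxy => ->.
Qed.

Lemma gdist_on_geodesic x p z : geodesic G l x p -> z \in x :: p ->
  gdist x z + gdist z (last x p) = gdist x (last x p).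
Proof.
rewrite inE => gp /predU1P[->|zp]; first by rewrite gdist_refl add0r.
case/splitPr: zp gp => p1 p2; rewrite -cat_rcons => gp.
have := gdist_geodesic (geodesic_catr gp); have := gdist_geodesic (geodesic_catl gp).
rewrite !last_cat !last_rcons => -> ->.
by have := gdist_geodesic gp; rewrite last_cat last_rcons walk_length_cat last_rcons.
Qed.

(** Dropped vertices are bypassed by the triangle inequality. *)
Lemma walk_length_filter (l' : {set V} -> R) (K : pred V) x p :
  (forall x y, l' [set x; y]%SET = gdist x y) ->
  path (adj G) x p ->
  walk_length l' x [seq y <- p | K y] <= walk_length l x p.
Proof.
move=> l'E; elim: p x => [|y p IH] x /=; first by rewrite !walk_length_nil.
move=> /andP[xy yp]; have {}IH := IH y yp.
have cxy := connect1 xy; have dxy : gdist x y <= l [set x; y]%SET.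
  have /gdist_le_walk : path (adj G) x [:: y] by rewrite /= xy.
  by rewrite walk_length_cons walk_length_nil addr0.
rewrite walk_length_cons; case: ifP => Ky.
  by rewrite walk_length_cons l'E lerD.
have : {subset [seq y <- p | K y] <= p} by move=> z; rewrite mem_filter => /andP[].
case E : [seq y <- p | K y] IH => [|z r] IH sub.
  rewrite walk_length_nil addr_ge0 ?(ltW (l_pos xy)) //.
  exact: (walk_length_ge0 l_pos yp).
have cyz : connect (adj G) y z.
  have /path_connect := yp; apply; rewrite inE sub ?mem_head ?orbT //.
move: IH; rewrite !walk_length_cons !l'E.
have := gdist_triangle cxy cyz; lra.
Qed.

End Distance.

Lemma dist_triangle_le (R : realType) (V : finType) (G : graph V) (l : {set V} -> R) x y z (a b : R) :
  positive_lengths G l -> (dist G l x y <= a%:E)%E -> (dist G l y z <= b%:E)%E ->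
  (dist G l x z <= (a + b)%:E)%E.
Proof.
move=> lp.
have [xy|nxy] := boolP (connect (adj G) x y); last by rewrite (dist_disconnected _ nxy).
have [yz|nyz] := boolP (connect (adj G) y z); last by rewrite (dist_disconnected _ nyz).
rewrite !dist_connected ?(connect_trans xy yz) // !lee_fin => h1 h2.
by apply: le_trans (gdist_triangle lp xy yz) _; apply: lerD.
Qed.

Lemma path_connect_restr (V : finType) (g : rel V) (X : pred V) x p :
  symmetric g -> path g x p -> all X (x :: p) -> {in x :: p &, forall y z, connect (restr g X) y z}.
Proof.
move=> gS xp aX; suff H y : y \in x :: p -> connect (restr g X) x y.
  move=> y z /H xy /H xz; apply: connect_trans xz.
  by rewrite connect_restr_sym.
move=> yp; apply: (path_connect _ yp).
elim: p x xp aX {y yp} => //= z p IH x /andP[xz zp] /and3P[Xx Xz Xp].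
by rewrite {1}/restr /= xz Xx Xz /=; apply: IH => //=; rewrite Xz.
Qed.

(** * Assembling the minor *)

Definition nonterminal_bound (k : nat) : nat := (2 * (8 * k * (1 + trunc_log 2 k)) ^ 2)%N.

(** The edges of the minor get the distances of [G] as lengths, so by the triangle inequality none
    of its walks undercuts [dist G]. The work lies in the factor 3. *)
Lemma planar_DAM (R : realType) (V : finType) (G : graph V) (l : {set V} -> R) (T : {set V}) :
  planar R G -> positive_lengths G l -> T \subset verts G ->
  admits_DAM T 3 (nonterminal_bound #|T|) G l.
Proof.
move=> plG lpos TG.
have gS := @adj_sym V G; have cS : connect_sym (adj G) by exact: sym_connect_sym.
have [w [wpos wl wgen]] := generic_lengths lpos.
(* Between different components the empty walk is chosen, so that [sp] is always a geodesic. *)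
have /choice[sp0 sp0P] : forall q : V * V, exists p, geodesic G w q.1 p /\
    (connect (adj G) q.1 q.2 -> last q.1 p = q.2).
  case=> x y /=; have [xy|nxy] := boolP (connect (adj G) x y); last first.
    exists [::]; split => //; split => // p xp _; rewrite walk_length_nil; exact: (walk_length_ge0 wpos xp).
  by have [p [gp _ lp]] := geodesic_exists wpos xy; exists p.
pose sp x y := sp0 (x, y).
have spg x y : geodesic G w x (sp x y) by have [] := sp0P (x, y).
have spl x y : connect (adj G) x y -> last x (sp x y) = y by have [_] := sp0P (x, y).
pose rt := fingraph.root (adj G).
have rtc a : connect (adj G) (rt a) a by rewrite cS connect_root.
pose pseq a := rt a :: sp (rt a) a.
pose P a : {set V} := [set z in pseq a]%SET.
have rP a : rt a \in P a by rewrite inE mem_head.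
have aP a : a \in P a by rewrite inE -{1}(spl _ _ (rtc a)) mem_last.
have path_in x p y : path (adj G) x p -> y \in x :: p -> connect (adj G) x y.
  by move=> xp yp; exact: (path_connect xp yp).
have Pconn a : connect (restr (adj G) (mem (P a))) a (rt a).
  have [xp _] := spg (rt a) a.
  have aa : all (mem (P a)) (pseq a) by apply/allP => z zp /=; rewrite inE.
  by apply: (path_connect_restr gS xp aa); [have := aP a|have := rP a]; rewrite inE.
have sepH (A : {set V}) : A \subset verts G -> exists s : seq V,
     [/\ (size s <= 4)%N, {subset s <= verts G} & forall x, let S := (\bigcup_(a <- s) P a)%SET in
        x \notin S -> (2 * #|A :&: component (adj G) S x| <= #|A|)%N].
  move=> AG; apply: (@planar_separator R V G P rt A plG AG) => // a b.
  by move/(fingraph.rootP cS).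
have [L [szL LP cov]] := separator_cover gS (fun a _ => aP a) sepH TG.
(* Nearest is meant for [l], although [P a] was selected by [w]. *)
pose nr a t := [arg min_(x < rt a in P a) gdist G l t x]%O.
have nrP a t : nr a t \in P a /\ forall z, z \in P a -> gdist G l t (nr a t) <= gdist G l t z.
  by rewrite /nr; case: arg_minP => [|x xP H]; [exact: rP|split].
(* A pair [b] contributes one path and a leg for each attached terminal, which is the cost
   [1 + #|b.2|] bounded by [separator_cover]. *)
pose F := flatten [seq pseq b.1 :: [seq t :: sp t (nr b.1 t) | t <- enum (b.2 : {set V})] | b : V * {set V} <- L].
have szF : (size F <= 8 * #|T| * (1 + trunc_log 2 #|T|))%N.
  apply: leq_trans szL; rewrite size_flatten /shape sumnE !big_map leq_sum // => b _.
  by rewrite /= size_map -cardE add1n.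
have pF b : b \in L -> pseq b.1 \in F.
  by move=> bL; apply/flattenP; eexists; [apply: map_f bL|rewrite mem_head].
have tF b t : b \in L -> t \in b.2 -> t :: sp t (nr b.1 t) \in F.
  move=> bL tb; apply/flattenP; eexists; first exact: map_f bL.
  by rewrite inE; apply/orP; right; apply: map_f; rewrite mem_enum.
have connG x y : connect (adj G) x y -> x \in verts G -> y \in verts G.
  case/connectP=> p + ->; elim: p x => //= z p IH x /andP[/adj_verts[_ zG _] zp] _.
  exact: IH.
have FP s : s \in F -> geodesic_seq G w s /\ {subset s <= verts G}.
  case/flattenP=> _ /mapP[b bL ->]; rewrite inE => /predU1P[->|/mapP[t]].
    split; first exact: spg.
    have [bG _] := LP _ bL; move=> z zp; have [xp _] := spg (rt b.1) b.1.
    apply: (connG (rt b.1)); first exact: path_in xp zp.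
    by apply: connG bG; rewrite cS.
  rewrite mem_enum => tb ->; split; first exact: spg.
  have [_ bT] := LP _ bL; move=> z zp; have [xp _] := spg t (nr b.1 t).
  apply: (connG t); first exact: path_in xp zp.
  by apply: (fintype.subsetP TG); apply: (fintype.subsetP bT).
have [H [mH vH sH cH]] := geodesic_family_minor wpos wgen FP TG.
set K := (T :|: _)%SET in vH sH.
pose D := gdist G l.
pose l' (e : {set V}) : R := if [pick q : V * V | e == [set q.1; q.2]%SET] is Some q then D q.1 q.2 else 1.
have l'E x y : l' [set x; y]%SET = D x y.
  rewrite /l'; case: pickP => [[u v] /= /eqP/set2_inj[[-> ->]|[-> ->]]|/(_ (x, y))] //=.
    exact: gdist_sym.
  by rewrite eqxx.
have l'pos : positive_lengths H l'.
  move=> e eH; have [/eqP/cards2P[x [y [nxy eE]]] _] := edges_wf eH; subst e.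
  by rewrite l'E; apply: gdist_gt0 => //; apply: cH.
have pathH x p : path (adj H) x p -> connect (adj G) x (last x p) /\ D x (last x p) <= walk_length l' x p.
  elim: p x => [|y p IH] x /=; first by rewrite /D gdist_refl // walk_length_nil.
  case/andP=> /cH xy /IH[yp le]; split; first exact: connect_trans xy yp.
  rewrite walk_length_cons l'E; apply: le_trans (gdist_triangle lpos xy yp) _.
  by rewrite lerD2l.
(* The part of [s] between [u] and [v] is a geodesic for [w], hence for [l], and its kept vertices
   form a walk in [H] that is no longer. *)
have Hle s u v : s \in F -> u \in s -> v \in s -> u \in K -> v \in K ->
    (dist H l' u v <= (D u v)%:E)%E.
  move=> sF us vs uK vK.
  have [->|nuv] := eqVneq u v.
    by rewrite /D gdist_refl // -(walk_length_nil l' v); exact: (@dist_le_walk _ _ _ _ v [::]).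
  wlog [s1 [s2 [s3 es]]] : u v us vs uK vK nuv / exists s1 s2 s3, s = s1 ++ u :: s2 ++ v :: s3.
    move=> W; have [a1 [a2 es]] : exists a1 a2, s = a1 ++ u :: a2 by case/splitPr: us => a1 a2; exists a1, a2.
    have := vs; rewrite es mem_cat inE eq_sym (negbTE nuv) /= => /orP[va|va].
      rewrite dist_sym (gdist_sym G l u v : D u v = D v u); apply: W => //; first by rewrite eq_sym.
      by rewrite es; case/splitPr: va => b1 b2; exists b1, b2, a2; rewrite -catA.
    by apply: W => //; rewrite es; case/splitPr: va => b1 b2; exists a1, b1, b2.
  have [gs _] := FP _ sF; rewrite es (_ : _ ++ _ = s1 ++ (u :: rcons s2 v) ++ s3) in gs; last by rewrite cat_cons cat_rcons.
  have /= /wl guv := geodesic_seq_catl (geodesic_seq_catr gs).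
  have Duv := gdist_geodesic guv; rewrite last_rcons in Duv.
  rewrite /D Duv; have le := walk_length_filter lpos (mem K) l'E (proj1 guv).
  have := sH _ sF; rewrite es filter_cat /= uK filter_cat /= vK => /cat_sorted2[_].
  rewrite /= -cat_rcons cat_path => /andP[Huv _].
  have := dist_le_walk l' Huv; rewrite last_rcons => /le_trans; apply.
  by rewrite lee_fin; move: le; rewrite filter_rcons ifT.
exists H, l'; split; last first.
  rewrite vH; apply: leq_trans (_ : size (branch_seq F) <= _)%N.
    apply: leq_trans (card_size _); apply: subset_leq_card; apply/fintype.subsetP => x.
    by rewrite !inE => /andP[/negbTE-> /=].
  apply: leq_trans (size_branch_seq F) _.
  by rewrite /nonterminal_bound leq_pmul2l // leq_exp2r.
split => // t t' tT t'T; split.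
  apply: le_dist => p xp lp; have [ctt' le] := pathH _ _ xp.
  by rewrite -lp dist_connected // lee_fin.
have [tt'|ntt'] := boolP (connect (adj G) t t'); last first.
  by rewrite (dist_disconnected l ntt') mulry gtr0_sg // mul1e leey.
have [q [gq _ lq]] := geodesic_exists lpos tt'.
(* The cover applies to arbitrary walks, so [q] may be a geodesic for [l] that [w] did not
   select. *)
have [b [bL tb]] := cov t q tT (etrans (congr1 (mem T) lq) t'T) (proj1 gq).
rewrite lq => t'b /hasP[z zq /= zP].
have [_ bT] := LP _ bL.
have tz : connect (adj G) t z by apply: path_in zq; case: gq.
have Pc z1 z2 : z1 \in P b.1 -> z2 \in P b.1 -> connect (adj G) z1 z2.
  have [xp _] := spg (rt b.1) b.1; rewrite !inE => /(path_in _ _ _ xp) h1 /(path_in _ _ _ xp) h2.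
  by apply: connect_trans h2; rewrite cS.
have inK x p : x :: p \in F -> x \in K /\ last x p \in K.
  by move=> /branch_seq_ends[h1 h2]; rewrite !inE h1 h2 !orbT.
have leg s : s \in b.2 -> connect (adj G) s z ->
   let x := nr b.1 s in [/\ connect (adj G) s x, x \in K, (dist H l' s x <= (D s x)%:E)%E & D s x <= D s z].
  move=> sb sz x; have [xP xmin] := nrP b.1 s.
  have sx : connect (adj G) s x by apply: connect_trans sz (Pc _ _ zP xP).
  have sF := tF _ _ bL sb; have [sK xK] := inK _ _ sF; rewrite spl // in xK.
  split => //; last exact: xmin.
  apply: Hle sF _ _ sK xK; first exact: mem_head.
  by have := mem_last s (sp s x); rewrite (spl _ _ sx).
have t'z : connect (adj G) t' z by apply: connect_trans tz; rewrite cS.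
have [tx xK tx1 tx2] := leg t tb tz; have [t'x x'K t'x1 t'x2] := leg t' t'b t'z.
set x := nr b.1 t in tx xK tx1 tx2; set x' := nr b.1 t' in t'x x'K t'x1 t'x2.
have [xP _] := nrP b.1 t; have [x'P _] := nrP b.1 t'.
have xx' : (dist H l' x x' <= (D x x')%:E)%E.
  by apply: (Hle _ _ _ (pF _ bL)) => //; [move: xP|move: x'P]; rewrite inE.
have := dist_triangle_le l'pos tx1 xx'; rewrite dist_sym in t'x1.
move=> /(dist_triangle_le l'pos) /(_ t'x1) /le_trans; apply.
rewrite (dist_connected lpos tt') -EFinM lee_fin -/(D t t').
have dz : D t z + D t' z = D t t'.
  by have := gdist_on_geodesic lpos gq zq; rewrite lq [gdist G l z t']gdist_sym.
(* Going back from [x] through [t] and [t'] bounds the middle part. The whole route costs at most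
   twice the two legs plus [D t t'], and the legs together are at most [D t z + D t' z], which is
   [D t t']. *)
have : D x x' <= D t x + D t t' + D t' x'.
  rewrite /D [gdist G l t x]gdist_sym.
  apply: le_trans (gdist_triangle lpos (_ : connect (adj G) x t') t'x) _.
    by apply: connect_trans tt'; rewrite cS.
  rewrite lerD2r; apply: (gdist_triangle lpos) => //; by rewrite cS.
lra.
Qed.

Theorem theorem6p6 :
  exists y : nat -> nat,
    softO y (fun k => (k ^ 2)%N) /\
    forall (R : realType) (V : finType) (G : graph V) (l : {set V} -> R)
           (T : {set V}),
      planar R G -> positive_lengths G l -> T \subset verts G ->
      admits_DAM T 3 (y #|T|) G l.
Proof.
exists nonterminal_bound; split; last by move=> *; exact: planar_DAM.
(* The constant is [2 * 8 ^ 2], and the logarithm is squared with the number of sequences. *)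
by exists 128, 2 => k; rewrite /nonterminal_bound !expnMn !mulnA.
Qed.
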